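(* Consider FedProx, as described in the context, with $\alpha>0$, run for $T\ge1$ rounds with constant step size $\gamma=[2L_\alpha\sqrt{TE}]^{-1}$, where $L_\alpha=\alpha+L$. Assume that the bounded variance, bounded stochastic gradient norm, $L$-smoothness and lower-bounded objective assumptions of the context hold. Let $\widehat{\mathbf{w}}_T$ be drawn uniformly at random from $\{\overline{\mathbf{w}}_{t,k}:0\le t\le T-1,\,0\le k\le E-1\}$. Then $$\mathbb{E}\|\nabla F(\widehat{\mathbf{w}}_T)\|^2\le\frac{1}{\sqrt T}\Big[\frac{8L_\alpha\Delta}{\sqrt E}+\frac{LS\sigma^2}{L_\alpha\sqrt E}+\frac{\alpha E^{3/2}G^2}{L_\alpha}\Big]+\frac{2L^2EG^2}{L_\alpha^2T}+\frac{\alpha^2L\sqrt E\,G^2}{16L_\alpha^3T^{3/2}},$$ where $\Delta=F(\overline{\mathbf{w}}_{0,0})-f_{\inf}$ and $S=\sum_ip_i^2$.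
   Context: Setting: there are $C$ clients with weights $p_1,\dots,p_C\ge0$ satisfying $\sum_ip_i=1$. Each client has a local objective $F_i:\mathbb{R}^D\to\mathbb{R}$, and the global objective is $F=\sum_ip_iF_i$. FedProx with parameter $\alpha>0$, $E\ge1$ local steps and step sizes $\gamma_t$ works as follows. Every client participates in every round. In round $t$, each client sets $\mathbf{w}^i_{t,0}=\overline{\mathbf{w}}_{t,0}$ and, for $k=0,\dots,E-1$, updates $$\mathbf{w}^i_{t,k+1}=(1-\alpha\gamma_t)\mathbf{w}^i_{t,k}+\alpha\gamma_t\overline{\mathbf{w}}_{t,0}-\gamma_tg_i(\mathbf{w}^i_{t,k}),$$ where $g_i$ is a stochastic gradient of $F_i$, sampled independently across clients and steps given the past. The average iterate is $\overline{\mathbf{w}}_{t,k}=\sum_ip_i\mathbf{w}^i_{t,k}$, with $\overline{\mathbf{w}}_{t+1,0}=\overline{\mathbf{w}}_{t,E}$. $\mathbb{E}$ denotes total expectation. Assumptions: - Bounded variance: $\mathbb{E}\,g_i(\mathbf{w}^i_{t,k})=\nabla F_i(\mathbf{w}^i_{t,k})$ and $\mathbb{E}\|g_i(\mathbf{w}^i_{t,k})-\nabla F_i(\mathbf{w}^i_{t,k})\|^2\le\sigma^2$. - Bounded stochastic gradient norm: $\mathbb{E}\|g_i(\mathbf{w}^i_{t,k})\|^2\le G^2$ for all $i,t,k$. - $L$-smoothness: each $\nabla F_i$ is $L$-Lipschitz. - Lower-bounded objective: $F$ is bounded below by $f_{\inf}$. *)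

(* Defs.v *)
From HB Require Import structures.
From mathcomp Require Import all_boot all_order all_algebra.
From mathcomp Require Import all_classical all_reals all_analysis.
Import numFieldNormedType.Exports.
Set Implicit Arguments. Unset Strict Implicit. Unset Printing Implicit Defensive.
Import Order.TTheory GRing.Theory Num.Theory.
Local Open Scope classical_set_scope.
Local Open Scope ring_scope.

Definition dotv (R : realType) (D : nat) (u v : 'rV[R]_D) : R :=
  \sum_(j < D) u ord0 j * v ord0 j.

Definition sqnorm (R : realType) (D : nat) (u : 'rV[R]_D) : R := dotv u u.

Definition is_gradient (R : realType) (D : nat) (f : 'rV[R]_D -> R)
    (g : 'rV[R]_D -> 'rV[R]_D) : Prop :=
  forall x : 'rV[R]_D, differentiable f x /\ forall h : 'rV[R]_D, 'd f x h = dotv (g x) h.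

Definition lipschitz_sq (R : realType) (D : nat) (g : 'rV[R]_D -> 'rV[R]_D) (L : R) : Prop :=
  forall x y : 'rV[R]_D, sqnorm (g x - g y) <= L ^+ 2 * sqnorm (x - y).

(* One client's local run inside a round: start point [s] (= \bar w_{t,0}),
   stochastic gradients [gi k] (= g_i(w^i_{t,k})), returns w^i_{t,k}. *)
Fixpoint local_iter (R : realType) (D : nat) (alpha gamma : R) (s : 'rV[R]_D)
    (gi : nat -> 'rV[R]_D) (k : nat) : 'rV[R]_D :=
  match k with
  | 0 => s
  | k'.+1 => (1 - alpha * gamma) *: local_iter alpha gamma s gi k'
             + (alpha * gamma) *: s - gamma *: gi k'
  end.

(* \bar w_{t,0} as a function of the sample point; [g i t k om] = g_i(w^i_{t,k}) at om *)
Fixpoint round_start (R : realType) (D C E : nat) (p : 'I_C -> R) (alpha gamma : R)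
    (Omega : Type) (w0 : 'rV[R]_D) (g : 'I_C -> nat -> nat -> Omega -> 'rV[R]_D)
    (t : nat) (om : Omega) : 'rV[R]_D :=
  match t with
  | 0 => w0
  | t'.+1 => \sum_(i < C) p i *:
       local_iter alpha gamma (@round_start R D C E p alpha gamma Omega w0 g t' om)
                  (fun k => g i t' k om) E
  end.

Definition wloc (R : realType) (D C E : nat) (p : 'I_C -> R) (alpha gamma : R)
    (Omega : Type) (w0 : 'rV[R]_D) (g : 'I_C -> nat -> nat -> Omega -> 'rV[R]_D)
    (i : 'I_C) (t k : nat) (om : Omega) : 'rV[R]_D :=
  local_iter alpha gamma (@round_start R D C E p alpha gamma Omega w0 g t om) (fun k => g i t k om) k.

Definition wavg (R : realType) (D C E : nat) (p : 'I_C -> R) (alpha gamma : R)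
    (Omega : Type) (w0 : 'rV[R]_D) (g : 'I_C -> nat -> nat -> Omega -> 'rV[R]_D)
    (t k : nat) (om : Omega) : 'rV[R]_D :=
  \sum_(i < C) p i *: @wloc R D C E p alpha gamma Omega w0 g i t k om.

Definition sub_measurable (d : measure_display) (Omega : measurableType d) (R : realType)
    (G : set (set Omega)) (f : Omega -> R) : Prop :=
  forall B : set R, measurable B -> G (f @^-1` B).

Definition sub_sigma (d : measure_display) (Omega : measurableType d)
    (G : set (set Omega)) : Prop :=
  sigma_algebra setT G /\ (forall A, G A -> measurable A).

Definition is_cond_exp (d : measure_display) (Omega : measurableType d) (R : realType)
    (P : probability Omega R) (G : set (set Omega)) (X Y : Omega -> R) : Prop :=
  [/\ P.-integrable setT (EFin \o X), P.-integrable setT (EFin \o Y),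
      sub_measurable G Y &
      forall A, G A -> (\int[P]_(om in A) (X om)%:E = \int[P]_(om in A) (Y om)%:E)%E].

Definition cond_indep (d : measure_display) (Omega : measurableType d) (R : realType)
    (P : probability Omega R) (G : set (set Omega)) (C D : nat)
    (X : 'I_C -> Omega -> 'rV[R]_D) : Prop :=
  forall (phi : 'I_C -> 'rV[R]_D -> R) (Y : 'I_C -> Omega -> R),
    (forall i, continuous (phi i)) ->
    (forall i, exists M : R, forall v, `|phi i v| <= M) ->
    (forall i, is_cond_exp P G (fun om => phi i (X i om)) (Y i)) ->
    is_cond_exp P G (fun om => \prod_(i < C) phi i (X i om))
                    (fun om => \prod_(i < C) Y i om).

(* Main.v *)
(* One averaged step is [w' = w - gamma (u + xi)], where the drift [u] is the average of
   the local gradients plus [alpha (w - start)] and [xi] is the averaged noise. The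
   descent lemma gives, as soon as [L gamma <= 1],
     F w' - F w <= - gamma/2 |grad F w|^2 + gamma/2 |grad F w - u|^2
                   - gamma <grad F w, xi> + L gamma^2 <u, xi> + L gamma^2/2 |xi|^2.
   The terms linear in [xi] vanish in mean since [grad F w] and [u] are known in the
   past; [E |xi|^2] is at most [sum_i p_i^2 sigma^2] since the clients are conditionally
   independent; and [|grad F w - u|^2] is at most [2 (L^2 + alpha^2)] times the weighted
   local deviation from the start of the round, of mean at most [gamma^2 E^2 G^2]. This
   inequality is telescoped pointwise before integrating, so that the integrability of
   [F w] never matters. *)
Require Import Defs.
From HB Require Import structures.
From mathcomp Require Import all_boot all_order all_algebra.
From mathcomp Require Import all_classical all_reals all_analysis.
From mathcomp Require Import measurable_realfun.
From mathcomp Require Import ring lra.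
Import numFieldNormedType.Exports.
Import Order.TTheory GRing.Theory Num.Theory.
Local Open Scope classical_set_scope.
Local Open Scope ring_scope.
Set Implicit Arguments. Unset Strict Implicit. Unset Printing Implicit Defensive.

(** * Euclidean geometry and the descent lemma *)

Section euclid.
Context (R : realType) (D : nat).
Implicit Types (u v w : 'rV[R]_D) (a c : R).

Lemma dotvC u v : dotv u v = dotv v u.
Proof. by apply: eq_bigr => j _; rewrite mulrC. Qed.

Lemma dotvDr u v w : dotv u (v + w) = dotv u v + dotv u w.
Proof. by rewrite /dotv -big_split; apply: eq_bigr => j _; rewrite mxE mulrDr. Qed.

Lemma dotvZr a u v : dotv u (a *: v) = a * dotv u v.
Proof. by rewrite /dotv mulr_sumr; apply: eq_bigr => j _; rewrite mxE mulrCA. Qed.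

Lemma dotvNr u v : dotv u (- v) = - dotv u v.
Proof. by rewrite -scaleN1r dotvZr mulN1r. Qed.

Lemma dotvDl u v w : dotv (u + v) w = dotv u w + dotv v w.
Proof. by rewrite dotvC dotvDr !(dotvC w). Qed.

Lemma dotvZl a u v : dotv (a *: u) v = a * dotv u v.
Proof. by rewrite dotvC dotvZr dotvC. Qed.

Lemma dotvNl u v : dotv (- u) v = - dotv u v.
Proof. by rewrite dotvC dotvNr dotvC. Qed.

Lemma dotv0r u : dotv u 0 = 0.
Proof. by rewrite -(scale0r u) dotvZr mul0r. Qed.

Lemma dotv_sumr (I : Type) (r : seq I) u (f : I -> 'rV[R]_D) :
  dotv u (\sum_(i <- r) f i) = \sum_(i <- r) dotv u (f i).
Proof.
by elim/big_rec2 : _ => [|i y x _ <-]; rewrite ?dotv0r// dotvDr.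
Qed.

Lemma dotv_suml (I : Type) (r : seq I) u (f : I -> 'rV[R]_D) :
  dotv (\sum_(i <- r) f i) u = \sum_(i <- r) dotv (f i) u.
Proof. by rewrite dotvC dotv_sumr; apply: eq_bigr => i _; rewrite dotvC. Qed.

Definition dotvE := (dotvDl, dotvDr, dotvZl, dotvZr, dotvNl, dotvNr).

Lemma sqnorm_ge0 u : 0 <= sqnorm u.
Proof. by apply: sumr_ge0 => j _; rewrite -expr2 sqr_ge0. Qed.

Lemma sqr_coord_le u j : u ord0 j ^+ 2 <= sqnorm u.
Proof.
rewrite /sqnorm /dotv (bigD1 j)//= expr2 lerDl.
by apply: sumr_ge0 => k _; rewrite -expr2 sqr_ge0.
Qed.

Lemma sqnormZ a u : sqnorm (a *: u) = a ^+ 2 * sqnorm u.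
Proof. by rewrite /sqnorm !dotvE mulrA. Qed.

Lemma sqnormD_le u v : sqnorm (u + v) <= 2 * (sqnorm u + sqnorm v).
Proof.
have := sqnorm_ge0 (u - v); rewrite /sqnorm !dotvE (dotvC v u); lra.
Qed.

(** Cauchy-Schwarz without square roots: for [c > 0], expand [0 <= |u - c v|^2] and cancel [2 c];
    for [c = 0], the assumption forces [u = 0]. *)
Lemma dotv_le c u v : 0 <= c -> sqnorm u <= c ^+ 2 * sqnorm v ->
  dotv u v <= c * sqnorm v.
Proof.
rewrite le_eqVlt => /predU1P[<-|c0 uv].
  rewrite expr2 !mul0r => u0; rewrite /dotv big1// => j _.
  suff /eqP : u ord0 j ^+ 2 = 0 by rewrite sqrf_eq0 => /eqP ->; rewrite mul0r.
  by apply/le_anti; rewrite sqr_ge0 andbT (le_trans (sqr_coord_le u j)).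
have h := sqnorm_ge0 (u - c *: v).
rewrite -subr_ge0 -(pmulr_rge0 _ c0).
by move: h uv; rewrite /sqnorm !dotvE (dotvC v u); lra.
Qed.

(** * Weighted means of vectors *)

Lemma weighted_variance (n : nat) (p : 'I_n -> R) (x : 'I_n -> 'rV[R]_D) :
  \sum_i p i = 1 ->
  \sum_i p i * sqnorm (x i - \sum_k p k *: x k) =
  \sum_i p i * sqnorm (x i) - sqnorm (\sum_k p k *: x k).
Proof.
move=> p1; set m := \sum_k p k *: x k.
have E : \sum_i p i * dotv (x i) m = sqnorm m.
  by rewrite [in RHS]/sqnorm [in RHS]/m dotv_suml; apply: eq_bigr => i _; rewrite dotvZl.
transitivity (\sum_i (p i * sqnorm (x i) - 2 * (p i * dotv (x i) m)
    + p i * sqnorm m)).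
  by apply: eq_bigr => i _; rewrite /sqnorm !dotvE (dotvC m); ring.
by rewrite big_split sumrB -mulr_sumr E -mulr_suml p1 /=; ring.
Qed.

(** Jensen's inequality, read off from the nonnegativity of the weighted variance. *)
Lemma sqnorm_convex (n : nat) (p : 'I_n -> R) (x : 'I_n -> 'rV[R]_D) :
  (forall i, 0 <= p i) -> \sum_i p i = 1 ->
  sqnorm (\sum_k p k *: x k) <= \sum_i p i * sqnorm (x i).
Proof.
move=> p0 p1; rewrite -subr_ge0 -weighted_variance//.
by apply: sumr_ge0 => i _; rewrite mulr_ge0// sqnorm_ge0.
Qed.

(** The points [x i - s] have the same variance as the [x i], and their second moment exceeds it by
    [|m - s|^2], where [m] is the mean. *)
Lemma sum_sqnorm_mean_le (n : nat) (p : 'I_n -> R) (x : 'I_n -> 'rV[R]_D) s :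
  \sum_i p i = 1 ->
  \sum_i p i * sqnorm (x i - \sum_k p k *: x k) <=
  \sum_i p i * sqnorm (x i - s).
Proof.
move=> p1.
have E : \sum_k p k *: (x k - s) = \sum_k p k *: x k - s.
  by under eq_bigr do rewrite scalerBr; rewrite sumrB -scaler_suml p1 scale1r.
have := @weighted_variance n p (fun i => x i - s) p1.
rewrite E; under eq_bigr do rewrite opprB subrKA.
by move=> ->; rewrite gerBl sqnorm_ge0.
Qed.

(** * Gradients and the descent inequality *)

(** Testing against basis vectors recovers each coordinate. This identifies any given global
    gradient with the weighted sum of the client gradients. *)
Lemma gradient_uniq (f : 'rV[R]_D -> R) (g1 g2 : 'rV[R]_D -> 'rV[R]_D) :
  is_gradient f g1 -> is_gradient f g2 -> g1 =1 g2.
Proof.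
move=> h1 h2 x; apply/rowP => j.
have : dotv (g1 x) (delta_mx ord0 j) = dotv (g2 x) (delta_mx ord0 j).
  by rewrite -(h1 x).2 (h2 x).2.
have dE u : dotv u (delta_mx ord0 j) = u ord0 j.
  rewrite /dotv (bigD1 j)//= mxE !eqxx mulr1 big1 ?addr0// => k kj.
  by rewrite mxE (negbTE kj) andbF mulr0.
by rewrite !dE.
Qed.

Lemma gradient_sum (n : nat) (p : 'I_n -> R) (f : 'I_n -> 'rV[R]_D -> R)
    (g : 'I_n -> 'rV[R]_D -> 'rV[R]_D) :
  (forall i, is_gradient (f i) (g i)) ->
  is_gradient (fun x => \sum_i p i * f i x) (fun x => \sum_i p i *: g i x).
Proof.
move=> fg x.
have df i : differentiable (p i \*: f i) x.
  by apply: differentiableZ; exact: (fg i x).1.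
have fE : (fun x => \sum_i p i * f i x) = \sum_i (p i \*: f i).
  by apply/funext => y; rewrite fct_sumE.
rewrite fE; split; first exact: differentiable_sum.
move=> h; rewrite -deriveE; last exact: differentiable_sum.
rewrite derive_sum => [|i]; last exact: diff_derivable.
rewrite dotv_suml; apply: eq_bigr => i _; have [dfi dE] := fg i x.
by rewrite deriveZ ?deriveE ?dE ?dotvZl//; exact: diff_derivable.
Qed.

(** The difference quotients at [s] of the restriction to the line are those of [f] at [x + s *: h]
    in direction [h]. *)
Lemma gradient_is_derive (f : 'rV[R]_D -> R) (g : 'rV[R]_D -> 'rV[R]_D) x h (s : R) :
  is_gradient f g ->
  is_derive s 1 (fun t : R => f (x + t *: h)) (dotv (g (x + s *: h)) h).
Proof.
move=> fg; have [df dE] := fg (x + s *: h).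
have dv := @diff_derivable _ _ _ f (x + s *: h) h df.
have E : (fun e : R => e^-1 *: (((fun t : R => f (x + t *: h)) \o shift s) (e *: (1 : R))
           - f (x + s *: h))) =
         (fun e : R => e^-1 *: ((f \o shift (x + s *: h)) (e *: h) - f (x + s *: h))).
  have shiftE (c e : R) : c = e -> x + (c + s) *: h = e *: h + (x + s *: h).
    by move=> ->; rewrite scalerDl addrCA.
  apply/funext => e; congr (_ *: (f _ - _)).
  exact: shiftE (mulr1 e).
apply: DeriveDef; first by rewrite /derivable E.
by rewrite /derive E -dE -deriveE.
Qed.

Lemma descent (f : 'rV[R]_D -> R) (g : 'rV[R]_D -> 'rV[R]_D) (L : R) x h :
  0 <= L -> is_gradient f g -> lipschitz_sq g L ->
  f (x + h) <= f x + dotv (g x) h + L / 2 * sqnorm h.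
Proof.
move=> L0 fg gL.
(* [F] is [f] along the segment minus the linear and quadratic terms of the bound. The mean value
   theorem gives [F 1 - F 0 = df c], so the claim amounts to [df c <= 0]. *)
pose df (s : R) := dotv (g (x + s *: h)) h - (dotv (g x) h + s * (L * sqnorm h)).
pose F (s : R) := f (x + s *: h) - (s * dotv (g x) h + s ^+ 2 / 2 * (L * sqnorm h)).
have dF (s : R) : is_derive s 1 F (df s).
  apply: is_deriveB; first exact: gradient_is_derive.
  apply: is_derive_eq.
  rewrite !scaler0 !add0r /GRing.scale/= !mulr1.
  by field.
have [|c /[!in_itv]/= /andP[c0 _]] := @MVT_segment R F df 0 1 ler01 (fun s _ => dF s).
  apply: continuous_subspaceT => s.
  have [dFs _] := dF s.
  exact/differentiable_continuous/derivable1_diffP.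
rewrite subr0 mulr1 => E.
(* Cauchy-Schwarz with constant [c * L]: the gradient moves by at most [L * c * |h|] between [x] and
   [x + c *: h]. *)
have dfc : df c <= 0.
  rewrite /df opprD addrA -dotvNl -dotvDl subr_le0 mulrA.
  apply: dotv_le; first exact: mulr_ge0.
  apply: (le_trans (gL _ _)); rewrite addrC addKr sqnormZ.
  by rewrite exprMn; nra.
move: E; rewrite /F scale1r scale0r addr0 => E.
by move: dfc; rewrite -E; nra.
Qed.

(** One step multiplies the deviation from [s] by [1 - alpha * gamma], which lies in [[0, 1]], and
    adds [- gamma *: gi k]. The squared norm of such a contracted sum of [k] terms costs a factor
    [k]. *)
Lemma local_iter_dev (alpha gamma : R) s (gi : nat -> 'rV[R]_D) k :
  0 <= alpha * gamma <= 1 ->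
  sqnorm (local_iter alpha gamma s gi k - s) <=
  gamma ^+ 2 * (k%:R * \sum_(j < k) sqnorm (gi j)).
Proof.
move=> /andP[ag0 ag1]; elim: k => [|k IH].
  by rewrite /= subrr /sqnorm dotv0r !mul0r mulr0.
rewrite big_ord_recr/=.
set x := local_iter _ _ _ _ k in IH *.
have -> : (1 - alpha * gamma) *: x + (alpha * gamma) *: s - gamma *: gi k - s
    = (1 - alpha * gamma) *: (x - s) - gamma *: gi k.
  by rewrite !(scalerBr, scalerBl, scale1r) opprB; apply/rowP => j; rewrite !mxE; ring.
set c := 1 - _; set S := \sum_(_ < k) _ in IH *.
have c1 : c ^+ 2 <= 1 by rewrite /c; nra.
have S0 : 0 <= S by apply: sumr_ge0 => j _; exact: sqnorm_ge0.
(* The Young inequality used below has as weight the number of steps already made. The first step,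
   where the deviation is zero, is therefore treated apart. *)
move: (x - s) IH => y {x} IH; clearbody S; case: k IH => [|k] IH.
  have {}IH : sqnorm y = 0.
    by apply/le_anti; rewrite sqnorm_ge0 andbT (le_trans IH)// !mul0r mulr0.
  have yg e : dotv (e *: y) (gi 0%N) <= 0.
    by rewrite -(mul0r (sqnorm (gi 0%N))) dotv_le// sqnormZ IH mulr0 expr2 !mul0r.
  have := yg (- 1); have := yg 1; move: IH.
  rewrite /sqnorm !dotvE (dotvC (gi _) y) => -> h1 h2.
  have -> : dotv y (gi 0%N) = 0 by lra.
  by have := sqr_ge0 gamma; nra.
set K : R := k.+1%:R in IH *.
have K0 : 0 < K by rewrite ltr0n.
have -> : k.+2%:R = K + 1 by rewrite /K -[k.+2%:R]natr1.
rewrite -(ler_pM2l K0).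
(* Young with weight [K]: [|c y - gamma g|^2 <= (1 + 1/K) |c y|^2 + (K + 1) gamma^2 |g|^2], here
   multiplied through by [K]. The induction hypothesis turns the first term into
   [(K + 1) gamma^2 S]. *)
have H1 := sqnorm_ge0 (c *: y + (K * gamma) *: gi k.+1).
have H2 : sqnorm (c *: y) <= gamma ^+ 2 * (K * S).
  by rewrite sqnormZ; apply: le_trans IH; rewrite ler_piMl ?sqnorm_ge0.
have H3 : (K + 1) * sqnorm (c *: y) <= (K + 1) * (gamma ^+ 2 * (K * S)).
  by rewrite ler_pM2l// ltr_wpDr.
move: H1 H3; rewrite /sqnorm !dotvE (dotvC (gi _) y) => H1 H3.
lra.
Qed.

(** After expansion the two sides differ by exactly [gamma / 2 * (1 - L * gamma) * |u|^2]. *)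
Lemma step_bound (L gamma : R) v u xi : 0 <= gamma -> L * gamma <= 1 ->
  dotv v (- gamma *: (u + xi)) + L / 2 * sqnorm (- gamma *: (u + xi)) <=
  - (gamma / 2) * sqnorm v + gamma / 2 * sqnorm (v - u)
  - gamma * dotv v xi + L * gamma ^+ 2 * dotv u xi
  + L * gamma ^+ 2 / 2 * sqnorm xi.
Proof.
move=> g0 Lg; have u0 := sqnorm_ge0 u.
have : 0 <= gamma / 2 * (1 - L * gamma) * sqnorm u.
  by rewrite !mulr_ge0// ?subr_ge0.
rewrite /sqnorm !dotvE (dotvC xi) (dotvC u v); lra.
Qed.

End euclid.

(** * Measurability and conditional expectation *)

Section sub_sigma_measurability.
Context (d : measure_display) (Omega : measurableType d) (R : realType).
Implicit Types (G : set (set Omega)) (f : Omega -> R).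

(** A sigma-algebra generates itself, so [sub_measurable] is plain measurability on the space
    generated by [G], and the usual closure properties apply. *)
Lemma sub_measurableP G f : sub_sigma G ->
  sub_measurable G f <->
  measurable_fun (setT : set (g_sigma_algebraType G)) f.
Proof.
move=> [sG _]; split=> [mf _ B mB|mf B mB].
  by rewrite setTI measurable_g_measurableTypeE//; exact: mf.
have := mf measurableT B mB.
by rewrite setTI measurable_g_measurableTypeE.
Qed.

Lemma sub_measurable_measurable G f : sub_sigma G ->
  sub_measurable G f -> measurable_fun setT f.
Proof. by move=> [_ GT] mf _ B mB; rewrite setTI; apply: GT; exact: mf. Qed.

Lemma sub_measurable_subset G H f : G `<=` H ->
  sub_measurable G f -> sub_measurable H f.
Proof. by move=> GH mf B mB; apply: GH; exact: mf. Qed.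

End sub_sigma_measurability.

Section lipschitz_measurability.
Context (d : measure_display) (T : measurableType d) (R : realType) (D : nat).

(* Replacing [X] by [floor (n X) / n] makes it countably valued, and [phi]
   moves by at most [K sqrt D / n]. *)
Lemma measurable_lipschitz_comp (phi : 'rV[R]_D -> R) (K : R) (X : T -> 'rV[R]_D) :
  (forall x y, (phi x - phi y) ^+ 2 <= K ^+ 2 * sqnorm (x - y)) ->
  (forall j, measurable_fun setT (fun t => X t ord0 j)) ->
  measurable_fun setT (fun t => phi (X t)).
Proof.
move=> phiK mX.
pose fl n t : 'rV[int]_D := \row_j Num.floor (n.+1%:R * X t ord0 j).
pose back n (z : 'rV[int]_D) : 'rV[R]_D := \row_j ((z ord0 j)%:~R / n.+1%:R).
have mfl n z : measurable [set t | fl n t = z].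
  rewrite (_ : [set t | _] = \bigcap_(j in [set: 'I_D])
     (fun t => n.+1%:R * X t ord0 j) @^-1` `[(z ord0 j)%:~R, (z ord0 j + 1)%:~R[%classic).
    apply: fin_bigcap_measurable => // j _.
    rewrite -[X in measurable X]setTI.
    by apply: (measurable_funM (measurable_cst _) (mX j)) => //.
  apply/seteqP; split=> t /=.
    by move=> <- j _ /=; rewrite in_itv/= mxE floor_le floorD1_gt.
  move=> H; apply/rowP => j; rewrite mxE; apply/floor_def.
  by have := H j Logic.I; rewrite /= in_itv.
apply: (@measurable_fun_cvg _ _ _ _ (fun n t => phi (back n (fl n t)))).
  move=> n _ B mB; rewrite setTI.
  (* The approximant depends on [t] only through an integer vector, so the preimage is a countable
     union of level sets of [fl n]. *)
  rewrite (_ : _ @^-1` B = \bigcup_z [set t | fl n t = z /\ B (phi (back n z))]).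
    apply: countable_bigcupT_measurable => // z.
    have [Bz|nBz] := pselect (B (phi (back n z))).
      rewrite (_ : [set t | _] = [set t | fl n t = z]) => //.
      by apply/seteqP; split=> t /=; [case|split].
    rewrite (_ : [set t | _] = set0) => //.
    by apply/seteqP; split=> t //= [].
  apply/seteqP; split=> t /=; first by move=> Bt; exists (fl n t).
  by move=> [z _ /= [-> ]].
move=> t _.
have bd n : (phi (back n (fl n t)) - phi (X t)) ^+ 2 <= K ^+ 2 * D%:R / n.+1%:R ^+ 2.
  apply: (le_trans (phiK _ _)); rewrite -mulrA ler_wpM2l ?sqr_ge0//.
  rewrite -[D in D%:R]card_ord -sum1_card natr_sum mulr_suml; apply: ler_sum => j _.
  rewrite !mxE -expr2 div1r -exprVn.
  have n0 : (0 : R) < n.+1%:R by rewrite ltr0n.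
  have fl1 := floor_le (n.+1%:R * X t ord0 j).
  have fl2 := floorD1_gt (n.+1%:R * X t ord0 j).
  set z := Num.floor _ in fl1 fl2 *.
  rewrite -[X in _ - X](mulKf (lt0r_neq0 n0)) [X in X - _]mulrC -mulrBr exprMn.
  rewrite ler_piMr ?sqr_ge0//.
  rewrite intrD in fl2; nra.
apply/cvgrPdist_lt => e e0; near=> n.
rewrite distrC -(ltr_pXn2r (n := 2))// ?nnegrE ?ltW// real_normK ?num_real//.
apply: (le_lt_trans (bd n)).
rewrite ltr_pdivrMr ?exprn_gt0//.
(* It suffices that [n + 1] exceed this ratio, because [n + 1 <= (n + 1)^2]. *)
have : K ^+ 2 * D%:R / e ^+ 2 < n.+1%:R.
  apply: (@lt_trans _ _ n%:R); last by rewrite ltr_nat.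
  by near: n; exact: nbhs_infty_gtr.
rewrite ltr_pdivrMr ?exprn_gt0// => /lt_le_trans; apply.
rewrite mulrC ler_pM2l ?exprn_gt0//.
by rewrite expr2 ler_peMr// ler1n.
Unshelve. all: by end_near.
Qed.

End lipschitz_measurability.

Section cond_exp_exists.
Context (R : realType) (d : measure_display) (Omega : measurableType d)
  (P : probability Omega R).
Local Open Scope ereal_scope.

(* Radon-Nikodym on the measurable space carried by [G]. *)
Lemma cond_exp_exists (G : set (set Omega)) (X : Omega -> R) : sub_sigma G ->
  P.-integrable setT (EFin \o X) -> exists Y, is_cond_exp P G X Y.
Proof.
move=> sG intX; have [sGa GT] := sG.
pose T' := g_sigma_algebraType G.
have mT' (A : set T') : measurable A = G A by rewrite measurable_g_measurableTypeE.
(* The identity into the coarser space pushes [P] to its restriction [mu] to [G], and the charge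
   sending [A] to the integral of [X] over [A] to its restriction [nu]. The density of [nu] with
   respect to [mu] is the conditional expectation. *)
pose i : Omega -> T' := id.
have mi : measurable_fun setT i by move=> _ A; rewrite mT' setTI => /GT.
pose I : {mfun Omega >-> T'} := HB.pack i (isMeasurableFun.Build _ _ _ _ i mi).
pose mu := distribution P I.
pose nu : {charge set T' -> \bar R} :=
  measure_function_pushforward__canonical__charge_Charge (induced_charge intX) mi.
have numu : nu `<< mu.
  apply/null_content_dominatesP => A; rewrite mT' => GA PA.
  apply: null_set_integral => //; first exact: GT.
  exact: measurable_funTS (measurable_int _ intX).
pose f := Radon_Nikodym nu mu.
have intf : mu.-integrable setT f by exact: Radon_Nikodym_integrable.
have mf : measurable_fun setT f := measurable_int _ intf.
have ffin x : f x \is a fin_num by exact: Radon_Nikodym_fin_num.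
have intfP : P.-integrable setT (f \o i).
  have /integrableP[_ foo] := intf; apply/integrableP; split.
    exact: measurableT_comp mf mi.
  rewrite (_ : \int[P]_x _ = \int[mu]_x `|f x|)//; apply/esym.
  by apply: (@ge0_integral_pushforward _ _ _ _ _ i mi P setT (abse \o f)) => //;
    [exact: measurableT_comp|move=> y _ /=; exact: abse_ge0].
have fE : EFin \o (fine \o f) = f by apply/funext => x; rewrite /= fineK.
exists (fine \o f); split => //.
- by rewrite fE; exact: intfP.
- by apply/sub_measurableP => //; exact: measurableT_comp.
- move=> A GA; rewrite -[LHS]/(nu A) (Radon_Nikodym_integral numu) ?mT'//.
  have intA : P.-integrable (i @^-1` A) (f \o i).
    by apply: integrableS intfP => //; exact: GT.
  rewrite [LHS](integral_pushforward mi mf intA) ?mT'//.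
  by apply: eq_integral => x _; rewrite /= fineK.
Qed.

End cond_exp_exists.

(** * Integrable and square-integrable functions on a probability space *)

Section expectation.
Context (R : realType) (d : measure_display) (Omega : measurableType d)
  (P : probability Omega R).
Implicit Types (f g X Y Z W : Omega -> R) (G : set (set Omega)).
Local Notation L1 := (Lfun P 1%E).
Local Notation L2 := (Lfun P 2%:E%E).

Lemma Lfun_measurable (p : \bar R) f : f \in Lfun P p -> measurable_fun setT f.
Proof. by move=> /sub_Lfun_mfun; rewrite inE. Qed.

Lemma sqr_integrable_Lfun2 f : measurable_fun setT f ->
  P.-integrable setT (EFin \o (fun x => f x ^+ 2)) -> f \in L2.
Proof.
move=> mf /integrableP[_ f2]; rewrite inE; apply/andP; split; rewrite inE//=.
rewrite /finite_norm unlock /Lnorm poweR_lty//.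
rewrite (le_lt_trans _ f2)//; apply: ge0_le_integral => //=.
- apply/measurable_EFinP/(@measurableT_comp _ _ _ _ _ _ (fun x : R => x `^ 2)) => //.
  exact: measurableT_comp.
- by apply/measurable_EFinP; apply: measurableT_comp => //; apply: measurable_funX.
- by move=> x _; rewrite lee_fin normrX powR_mulrn.
Qed.

Lemma Lfun1_le f g : measurable_fun setT f -> g \in L1 ->
  (forall x, `|f x| <= `|g x|) -> f \in L1.
Proof.
move=> mf /Lfun1_integrable ig fg; apply/Lfun1_integrable.
apply: le_integrable ig => //; first exact/measurable_EFinP.
by move=> x _; rewrite lee_fin.
Qed.

Lemma Lfun2_le f g : measurable_fun setT f -> g \in L2 ->
  (forall x, `|f x| <= `|g x|) -> f \in L2.
Proof.
move=> mf /Lfun2_integrable_sqr ig fg; apply: sqr_integrable_Lfun2 => //.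
apply: le_integrable ig => //.
  by apply/measurable_EFinP; exact: measurable_funX.
by move=> x _; rewrite lee_fin !normrX lerXn2r ?nnegrE.
Qed.

Lemma Lfun2_1 f : f \in L2 -> f \in L1.
Proof. by apply: Lfun_subset12; exact: fin_num_measure. Qed.

Lemma Lfun2_bounded f (M : R) : measurable_fun setT f ->
  (forall x, `|f x| <= M) -> f \in L2.
Proof.
move=> mf fM; apply: (Lfun2_le mf (Lfun_cst P M 2)) => x.
by rewrite (le_trans (fM x)) ?ler_norm.
Qed.

Lemma Lfun2D f g : f \in L2 -> g \in L2 -> (fun x => f x + g x) \in L2.
Proof. by move=> f2 g2; rewrite -[X in X \in _]/(f + g) rpredD ?lee1n. Qed.

Lemma Lfun2B f g : f \in L2 -> g \in L2 -> (fun x => f x - g x) \in L2.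
Proof. by move=> f2 g2; rewrite -[X in X \in _]/(f - g) rpredB ?lee1n. Qed.

Lemma Lfun2Z (a : R) f : f \in L2 -> (fun x => a * f x) \in L2.
Proof. by move=> f2; rewrite -[X in X \in _]/(a *: f) rpredZ ?lee1n. Qed.

Lemma Lfun2_sum (I : Type) (r : seq I) (f : I -> Omega -> R) :
  (forall i, f i \in L2) -> (fun x => \sum_(i <- r) f i x) \in L2.
Proof.
move=> f2; rewrite (_ : (fun _ => _) = \sum_(i <- r) f i) ?rpred_sum ?lee1n//.
by apply/funext => x; rewrite fct_sumE.
Qed.

Lemma Lfun2M f g : f \in L2 -> g \in L2 -> (fun x => f x * g x) \in L1.
Proof. exact: Lfun2_mul_Lfun1. Qed.

Lemma Lfun1D f g : f \in L1 -> g \in L1 -> (fun x => f x + g x) \in L1.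
Proof. by move=> f1 g1; rewrite -[X in X \in _]/(f + g) rpredD ?lexx. Qed.

Lemma Lfun1B f g : f \in L1 -> g \in L1 -> (fun x => f x - g x) \in L1.
Proof. by move=> f1 g1; rewrite -[X in X \in _]/(f - g) rpredB ?lexx. Qed.

Lemma Lfun1Z (a : R) f : f \in L1 -> (fun x => a * f x) \in L1.
Proof. by move=> f1; rewrite -[X in X \in _]/(a *: f) rpredZ ?lexx. Qed.

Lemma Lfun1_sum (I : Type) (r : seq I) (f : I -> Omega -> R) :
  (forall i, f i \in L1) -> (fun x => \sum_(i <- r) f i x) \in L1.
Proof.
move=> f1; rewrite (_ : (fun _ => _) = \sum_(i <- r) f i) ?rpred_sum ?lexx//.
by apply/funext => x; rewrite fct_sumE.
Qed.

Lemma RintegralD1 f g : f \in L1 -> g \in L1 ->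
  \int[P]_x (f x + g x) = \int[P]_x f x + \int[P]_x g x.
Proof. by move=> /Lfun1_integrable ? /Lfun1_integrable ?; exact: RintegralD. Qed.

Lemma RintegralB1 f g : f \in L1 -> g \in L1 ->
  \int[P]_x (f x - g x) = \int[P]_x f x - \int[P]_x g x.
Proof. by move=> /Lfun1_integrable ? /Lfun1_integrable ?; exact: RintegralB. Qed.

Lemma RintegralZ1 (a : R) f : f \in L1 ->
  \int[P]_x (a * f x) = a * \int[P]_x f x.
Proof. by move=> /Lfun1_integrable ?; exact: RintegralZl. Qed.

Lemma Rintegral_sum1 (I : Type) (r : seq I) (f : I -> Omega -> R) :
  (forall i, f i \in L1) ->
  \int[P]_x (\sum_(i <- r) f i x) = \sum_(i <- r) \int[P]_x f i x.
Proof.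
move=> f1; elim: r => [|i r IH].
  by under eq_Rintegral do rewrite big_nil; rewrite Rintegral_cst// mul0r big_nil.
under eq_Rintegral do rewrite big_cons.
by rewrite RintegralD1 ?IH ?big_cons//; exact: Lfun1_sum.
Qed.

Lemma le_Rintegral1 f g : f \in L1 -> g \in L1 -> (forall x, f x <= g x) ->
  \int[P]_x f x <= \int[P]_x g x.
Proof.
by move=> /Lfun1_integrable ? /Lfun1_integrable ? fg; apply: le_Rintegral.
Qed.

(** * Truncation, and orthogonality to [G]-measurable functions *)

Definition clip (n : nat) (x : R) := Num.max (- n%:R) (Num.min x n%:R).

Lemma normr_clip_le n x : `|clip n x| <= `|x|.
Proof.
have n0 : (0 : R) <= n%:R by [].
have x0 := normr_ge0 x; have := ler_norm (- x); have := ler_norm x.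
rewrite normrN => h1 h2; rewrite ler_norml le_max ge_max le_min ge_min h1 /=.
by rewrite andbT; apply/andP; split; [apply/orP; right; apply/andP; split|]; lra.
Qed.

Lemma clip_bound n x : `|clip n x| <= n%:R.
Proof.
rewrite /clip; have n0 : (0 : R) <= n%:R by [].
rewrite ler_norml; apply/andP; split; first by rewrite le_max lexx.
by rewrite ge_max ge_min lexx orbT andbT; lra.
Qed.

Lemma clip_id n x : `|x| <= n%:R -> clip n x = x.
Proof.
by rewrite ler_norml /clip => /andP[h1 h2]; rewrite (min_idPl h2) (max_idPr h1).
Qed.

(** [x] and its truncation have the same sign, and the truncation is the smaller in absolute
    value. *)
Lemma clip_mul_ge n x : clip n x ^+ 2 <= x * clip n x.
Proof.
rewrite /clip; have n0 : (0 : R) <= n%:R by [].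
by case: (leP x n%:R) => xn; case: (leP (- n%:R)) => h //; nra.
Qed.

Lemma clip_sqr_mono m n x : (m <= n)%N -> clip m x ^+ 2 <= clip n x ^+ 2.
Proof.
move=> mn; have mnR : (m%:R : R) <= n%:R by rewrite ler_nat.
have m0 : (0 : R) <= m%:R by [].
rewrite /clip.
by case: (leP x m%:R) => xm; case: (leP (- m%:R)) => hm;
  case: (leP x n%:R) => xn; case: (leP (- n%:R)) => hn //; nra.
Qed.

Lemma measurable_clip n : measurable_fun setT (clip n).
Proof. by apply: measurable_maxr => //; exact: measurable_minr. Qed.

Lemma cvg_clip x : \forall n \near \oo, clip n x = x.
Proof.
near=> n; apply: clip_id; near: n; exact: nbhs_infty_ger.
Unshelve. all: by end_near. Qed.

(** Dominated convergence under [|W X|]: at each point the truncation is eventually inactive. *)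
Lemma Rintegral_clip_limit W X : measurable_fun setT W -> measurable_fun setT X ->
  (fun x => W x * X x) \in L1 -> (forall n, \int[P]_x (W x * clip n (X x)) = 0) ->
  \int[P]_x (W x * X x) = 0.
Proof.
move=> mW mX WX H.
have mWX n : measurable_fun setT (fun x => W x * clip n (X x)).
  by apply: measurable_funM => //; exact: measurableT_comp (measurable_clip n) mX.
have WXn n x : `|W x * clip n (X x)| <= `|W x * X x|.
  by rewrite !normrM ler_wpM2l// normr_clip_le.
have [|||||_ _] := @dominated_convergence _ _ _ P setT measurableT
  (fun n x => (W x * clip n (X x))%:E) (fun x => (W x * X x)%:E)
  (fun x => `|W x * X x|%:E).
- by move=> n; exact/measurable_EFinP.
- exact/measurable_EFinP/(Lfun_measurable WX).
- apply: aeW => x _; apply: cvg_near_cst.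
  by apply: filterS (cvg_clip (X x)) => n ->.
- by apply/Lfun1_integrable; exact: Lfun_norm.
- by apply: aeW => x n _; rewrite lee_fin.
rewrite (_ : [sequence _]_n = cst 0%E).
  by move=> /(cvg_unique _ (cvg_cst _)) E; rewrite /Rintegral -E.
apply/funext => n /=; have /Lfun1_integrable WXn1 := Lfun1_le (mWX n) WX (WXn n).
by rewrite -[LHS]fineK ?integrable_fin_num// -[fine _]/(\int[P]_x _) H.
Qed.

(* [Z] is within [1/(n+1)] of a finite combination of indicators of events of [G]. *)
Lemma Rintegral_bounded_eq0 G W Z (M : R) : sub_sigma G -> W \in L1 ->
  (forall A, G A -> \int[P]_(x in A) W x = 0) ->
  sub_measurable G Z -> (forall x, `|Z x| <= M) ->
  \int[P]_x (W x * Z x) = 0.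
Proof.
move=> sG W1 WG mZ ZM; have mZ' := sub_measurable_measurable sG mZ.
have mW := Lfun_measurable W1.
pose q (n k : nat) : R := k%:R / n.+1%:R - M.
pose A n k := Z @^-1` `[q n k, q n k.+1[%classic.
have GA n k : G (A n k) by exact: mZ.
have mA n k : measurable (A n k) by apply: sG.2.
(* The successor makes the last half-open cell contain the top value [M]. *)
pose N n := (Num.truncn (n.+1%:R * (2 * M))).+1.
pose Zn n x := \sum_(k < N n) q n k * \1_(A n k) x.
have WA n k : (fun x => W x * \1_(A n k) x) \in L1.
  apply: Lfun1_le W1 _ => [|x]; first exact: measurable_funM.
  by rewrite normrM ler_piMr// indicE; case: (_ \in _); rewrite ?normr0 ?normr1.
have WAE n k x : q n k * (W x * \1_(A n k) x) = W x * (q n k * \1_(A n k) x).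
  by rewrite mulrCA.
have WZn1 n : (fun x => W x * Zn n x) \in L1.
  under eq_fun do rewrite mulr_sumr; under eq_fun do under eq_bigr do rewrite -WAE.
  by apply: Lfun1_sum => k; exact: Lfun1Z.
have WZn0 n : \int[P]_x (W x * Zn n x) = 0.
  under eq_Rintegral do rewrite mulr_sumr.
  under eq_Rintegral do under eq_bigr do rewrite -WAE.
  rewrite Rintegral_sum1 => [|k]; last exact: Lfun1Z.
  rewrite big1// => k _; rewrite RintegralZ1//.
  have := WG _ (GA n k); rewrite Rintegral_mkcond patch_indic => ->.
  by rewrite mulr0.
have WZ1 : (fun x => W x * Z x) \in L1.
  apply: (Lfun1_le _ (Lfun1Z M W1)) => [|x]; first exact: measurable_funM.
  by rewrite mulrC !normrM ler_wpM2r// (le_trans (ZM x))// ler_norm.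
have ZnZ n x : `|Z x - Zn n x| <= n.+1%:R^-1.
  have n0 : (0 : R) < n.+1%:R by rewrite ltr0n.
  have /ler_normlP[ZM1 ZM2] := ZM x.
  have Z0 : 0 <= n.+1%:R * (Z x + M) by apply: mulr_ge0 => //; lra.
  (* [k] indexes the only cell containing [Z x], so [Zn n x] is the left endpoint of that cell. *)
  set k := Num.truncn (n.+1%:R * (Z x + M)).
  have /andP[k1 k2] := truncn_itv Z0; rewrite -/k in k1 k2.
  have kN : (k < N n)%N.
    rewrite /N ltnS; apply: le_truncn; rewrite ler_pM2l//; lra.
  have qE j : (q n j <= Z x) = (j%:R <= n.+1%:R * (Z x + M)).
    by rewrite /q lerBlDr ler_pdivrMr// mulrC.
  have qE' j : (Z x < q n j) = (n.+1%:R * (Z x + M) < j%:R).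
    by rewrite ltNge qE -ltNge.
  have AE j : \1_(A n j) x = (j == k)%:R :> R.
    rewrite indicE; congr (nat_of_bool _)%:R; apply/idP/eqP.
      by rewrite inE /A/= in_itv/= qE qE' => H; apply/esym/truncn_def.
    by move=> ->; rewrite inE /A/= in_itv/= qE qE' k1.
  have -> : Zn n x = q n k.
    rewrite /Zn (bigD1 (Ordinal kN))//= AE eqxx mulr1 big1 ?addr0// => j jk.
    by rewrite AE; case: eqP => [E|_]; rewrite ?mulr0//; case/eqP: jk; exact: val_inj.
  have h1 : q n k <= Z x by rewrite qE.
  rewrite ger0_norm ?subr_ge0//.
  have : Z x < q n k.+1 by rewrite qE'.
  rewrite /q -[k.+1%:R]natr1 mulrDl mul1r.
  by move: (n.+1%:R^-1) => a; move: (_ * a) => b; lra.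
(* The integral against [Zn n] is zero, and passing to [Z] costs at most [1 / (n + 1)] times the
   integral of [|W|]. As [n] is arbitrary, the integral against [Z] is zero. *)
have B n : `|\int[P]_x (W x * Z x)| * n.+1%:R <= \int[P]_x `|W x|.
  have n0 : (0 : R) < n.+1%:R by rewrite ltr0n.
  rewrite -[X in `|X|]subr0 -{1}(WZn0 n) -RintegralB1//.
  rewrite -ler_pdivlMr//.
  have D1 : (fun x => W x * Z x - W x * Zn n x) \in L1 by exact: Lfun1B.
  have W1n := Lfun_norm W1.
  apply: (le_trans (le_normr_Rintegral measurableT _)); first exact/Lfun1_integrable.
  rewrite mulrC -RintegralZ1//; apply: le_Rintegral1.
  - exact: Lfun_norm D1.
  - exact: Lfun1Z.
  - by move=> x; rewrite -mulrBr normrM mulrC ler_wpM2r.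
apply/eqP; rewrite -normr_eq0; apply/contraT => c0.
have {}c0 : 0 < `|\int[P]_x (W x * Z x)| by rewrite lt_def c0/=.
have := B (Num.truncn (\int[P]_x `|W x| / `|\int[P]_x (W x * Z x)|)).
by rewrite leNgt mulrC -ltr_pdivrMr// truncnS_gt.
Qed.

(** Truncating [Z] makes it bounded and keeps it [G]-measurable; the truncation is then removed in
    the limit. *)
Lemma Rintegral_orthogonal G W Z : sub_sigma G -> W \in L1 ->
  (forall A, G A -> \int[P]_(x in A) W x = 0) ->
  sub_measurable G Z -> (fun x => W x * Z x) \in L1 ->
  \int[P]_x (W x * Z x) = 0.
Proof.
move=> sG W1 WG mZ WZ.
apply: Rintegral_clip_limit => //; first exact: Lfun_measurable W1.
  exact: sub_measurable_measurable mZ.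
move=> n; apply: (@Rintegral_bounded_eq0 G _ _ n%:R) => //.
  move=> B mB; rewrite -[_ @^-1` _]/(Z @^-1` (clip n @^-1` B)); apply: mZ.
  by rewrite -[X in measurable X]setTI; exact: measurable_clip.
by move=> x; exact: clip_bound.
Qed.

(** * Conditional expectations *)

Lemma cond_exp_Lfun1 G X Y : is_cond_exp P G X Y -> X \in L1 /\ Y \in L1.
Proof. by move=> [X1 Y1 _ _]; split; apply/Lfun1_integrable. Qed.

Lemma cond_exp_Rintegral G X Y : sub_sigma G -> is_cond_exp P G X Y ->
  \int[P]_x X x = \int[P]_x Y x.
Proof.
move=> [[G0 GC _] _] [_ _ _ XY]; rewrite /Rintegral XY//.
by rewrite -(setD0 setT); exact: GC.
Qed.

Lemma cond_exp_orthogonal G X Y Z : sub_sigma G -> is_cond_exp P G X Y ->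
  sub_measurable G Z -> (fun x => (X x - Y x) * Z x) \in L1 ->
  \int[P]_x ((X x - Y x) * Z x) = 0.
Proof.
move=> sG XY mZ XYZ; have [X1 Y1] := cond_exp_Lfun1 XY.
apply: (Rintegral_orthogonal sG (Lfun1B X1 Y1)) => // A GA.
have mA := sG.2 _ GA.
have [iX iY _ XYA] := XY.
rewrite RintegralB//; [|exact: integrableS iX|exact: integrableS iY].
by rewrite /Rintegral XYA// subrr.
Qed.

(** With [c] a truncation of [Y], orthogonality gives [E c^2 <= E (Y c) = E (X c) <= (E X^2 + E c^2)
    / 2], so [E c^2 <= E X^2] at every level. Monotone convergence then reaches [Y] itself. *)
Lemma cond_exp_Lfun2 G X Y : sub_sigma G -> is_cond_exp P G X Y ->
  X \in L2 -> Y \in L2.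
Proof.
move=> sG XY X2; have [X1 Y1] := cond_exp_Lfun1 XY; have [_ _ GY _] := XY.
have mY := Lfun_measurable Y1; have mX := Lfun_measurable X1.
have mc n : measurable_fun setT (fun x => clip n (Y x)).
  exact: measurableT_comp (measurable_clip n) mY.
have c2 n : (fun x => clip n (Y x)) \in L2.
  by apply: (Lfun2_bounded (mc n)) => x; exact: clip_bound.
have Gc n : sub_measurable G (fun x => clip n (Y x)).
  move=> B mB; rewrite -[_ @^-1` _]/(Y @^-1` (clip n @^-1` B)); apply: GY.
  by rewrite -[X in measurable X]setTI; exact: measurable_clip.
have cM n f : f \in L1 -> (fun x => f x * clip n (Y x)) \in L1.
  move=> f1; apply: (Lfun1_le _ (Lfun1Z n%:R f1)) => [|x].
    by apply: measurable_funM => //; exact: Lfun_measurable f1.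
  by rewrite mulrC !normrM ler_wpM2r// (le_trans (clip_bound _ _))// ler_norm.
have X2' := Lfun2M X2 X2.
have B n : \int[P]_x (clip n (Y x) ^+ 2) <= \int[P]_x (X x * X x).
  have cc := Lfun2M (c2 n) (c2 n).
  have H0 := cond_exp_orthogonal sG XY (Gc n) (cM n _ (Lfun1B X1 Y1)).
  have E : \int[P]_x (Y x * clip n (Y x)) = \int[P]_x (X x * clip n (Y x)).
    apply/eqP; rewrite eq_sym -subr_eq0 -RintegralB1 ?cM// -[X in _ == X]H0.
    by apply/eqP/eq_Rintegral => x _; rewrite mulrBl.
  have H1 : \int[P]_x (clip n (Y x) * clip n (Y x)) <= \int[P]_x (Y x * clip n (Y x)).
    by apply: le_Rintegral1 => // [|x]; [exact: cM|rewrite -expr2 clip_mul_ge].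
  have H2 : \int[P]_x (X x * clip n (Y x)) <=
      2^-1 * (\int[P]_x (X x * X x) + \int[P]_x (clip n (Y x) * clip n (Y x))).
    rewrite -RintegralD1// -RintegralZ1 ?Lfun1D//; apply: le_Rintegral1.
    - exact: cM.
    - by apply: Lfun1Z; exact: Lfun1D.
    - by move=> x; have := sqr_ge0 (X x - clip n (Y x)); rewrite sqrrB; lra.
  under eq_Rintegral do rewrite expr2.
  by rewrite E in H1; lra.
apply: sqr_integrable_Lfun2 => //; apply/integrableP; split.
  by apply/measurable_EFinP; exact: measurable_funX.
apply: (@le_lt_trans _ _ (\int[P]_x (X x * X x))%:E); last exact: ltry.
have cv x : (clip n (Y x) ^+ 2)%:E @[n --> \oo] --> (Y x ^+ 2)%:E.
  by apply: cvg_near_cst; apply: filterS (cvg_clip (Y x)) => n ->.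
rewrite (eq_integral (fun x => limn (fun n => (clip n (Y x) ^+ 2)%:E))); last first.
  by move=> x _; rewrite (cvg_lim _ (cv x))//= ger0_norm ?sqr_ge0.
have := @cvg_monotone_convergence _ _ _ P setT measurableT
  (fun n x => (clip n (Y x) ^+ 2)%:E).
move=> /(_ _ _ _)/wrap[].
- by move=> n; apply/measurable_EFinP; exact: measurable_funX.
- by move=> n x _; rewrite lee_fin sqr_ge0.
- by move=> x _ m n mn; rewrite lee_fin clip_sqr_mono.
move=> cvI; rewrite -(cvg_lim _ cvI)//; apply: lime_le; first exact: cvgP cvI.
apply: nearW => n; have cc := Lfun2_integrable_sqr (c2 n).
by rewrite -[leLHS]fineK ?integrable_fin_num// lee_fin; exact: B.
Qed.

End expectation.

(** * Conditional independence and uncorrelated noise *)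

Section conditional_independence.
Context (R : realType) (d : measure_display) (Omega : measurableType d)
  (P : probability Omega R) (G : set (set Omega)) (sG : sub_sigma G).

Lemma cond_exp_cst (c : R) : is_cond_exp P G (fun=> c) (fun=> c).
Proof.
split => //; [exact: finite_measure_integrable_cst..|].
by apply/sub_measurableP => //; exact: measurable_cst.
Qed.

Lemma clip_continuous n : continuous (@clip R n).
Proof.
move=> x; have cstc (c : R) : {for x, continuous (cst c : R -> R^o)} by exact: cvg_cst.
have idc : {for x, continuous (id : R -> R^o)} by exact: cvg_id.
exact: (continuous_max (cstc (- n%:R)) (continuous_min idc (cstc n%:R))).
Qed.

Lemma prod_two (n : nat) (a b : 'I_n) (x y : R) : a != b ->
  \prod_(c < n) (if c == a then x else if c == b then y else 1) = x * y.
Proof.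
move=> ab; have ba : b != a by rewrite eq_sym.
rewrite (bigD1 a)//= eqxx (bigD1 b)//= (negbTE ba) eqxx.
by rewrite big1 ?mulr1// => c /andP[/negbTE -> /negbTE ->].
Qed.

(* [cond_indep] only speaks of bounded continuous functions: both coordinates are
   first truncated, then the truncations are removed one after the other, the
   conditional expectation of the remaining truncated coordinate being moved
   from one factor to the other. *)
Lemma cond_indep_uncorrelated (n D : nat) (X : 'I_n -> Omega -> 'rV[R]_D)
    (a b : 'I_n) (i j : 'I_D) (Ha Hb : Omega -> R) :
  cond_indep P G X -> a != b ->
  is_cond_exp P G (fun om => X a om ord0 i) Ha ->
  is_cond_exp P G (fun om => X b om ord0 j) Hb ->
  (fun om => X a om ord0 i) \in Lfun P 2%:E%E ->
  (fun om => X b om ord0 j) \in Lfun P 2%:E%E ->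
  \int[P]_om ((X a om ord0 i - Ha om) * (X b om ord0 j - Hb om)) = 0.
Proof.
set xa := fun om => X a om ord0 i; set xb := fun om => X b om ord0 j.
move=> ind ab eA eB xa2 xb2.
have ha2 := cond_exp_Lfun2 sG eA xa2; have hb2 := cond_exp_Lfun2 sG eB xb2.
have [_ _ GHa _] := eA; have [_ _ GHb _] := eB.
have mxa := Lfun_measurable xa2; have mxb := Lfun_measurable xb2.
have c2 m (x : Omega -> R) : measurable_fun setT x ->
    (fun om => clip m (x om)) \in Lfun P 2%:E%E.
  move=> mx; apply: Lfun2_bounded (fun om => clip_bound m (x om)).
  exact: measurableT_comp (measurable_clip m) mx.
have ce m (x : Omega -> R) : measurable_fun setT x ->
    {Y | is_cond_exp P G (fun om => clip m (x om)) Y}.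
  move=> mx; apply: cid; apply: cond_exp_exists => //.
  by apply/Lfun1_integrable/Lfun2_1; exact: c2.
(* Write [A], [B] for the truncated coordinates and [Y], [Z] for their conditional expectations.
   Conditional independence gives [E (A B) = E (Y Z)], and [E (Y Z) = E (Y B)] since [Y] is
   [G]-measurable. *)
have clip_clip m k (Y : Omega -> R) :
    is_cond_exp P G (fun om => clip m (xa om)) Y ->
    \int[P]_om ((clip m (xa om) - Y om) * clip k (xb om)) = 0.
  move=> eY; have [Z eZ] := ce k xb mxb.
  have Y2 := cond_exp_Lfun2 sG eY (c2 _ _ mxa).
  have Z2 := cond_exp_Lfun2 sG eZ (c2 _ _ mxb).
  have [_ _ GY _] := eY.
  (* Clients other than [a] and [b] receive the constant test function 1. *)
  have := ind (fun c v => if c == a then clip m (v ord0 i)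
                          else if c == b then clip k (v ord0 j) else 1)
              (fun c => if c == a then Y else if c == b then Z else fun=> 1).
  move=> /(_ _ _ _)/wrap[c v|c|c|].
  - have cclip q (i' : 'I_D) :
        {for v, continuous (fun v : 'rV[R]_D => clip q (v ord0 i'))}.
      apply: (@continuous_comp _ _ _ (fun v : 'rV[R]_D => v ord0 i') (@clip R q)).
        exact: coord_continuous.
      exact: clip_continuous.
    by case: (c == a); [exact: cclip|case: (c == b); [exact: cclip|exact: cst_continuous]].
  - case: (c == a); first by exists m%:R => v; exact: clip_bound.
    case: (c == b); first by exists k%:R => v; exact: clip_bound.
    by exists 1 => v; rewrite normr1.
  - have [->//|_] := eqVneq c a; have [->//|_] := eqVneq c b.
    exact: cond_exp_cst.
  move=> /(cond_exp_Rintegral sG).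
  have -> : (fun om => \prod_(c < n) (if c == a then clip m (X c om ord0 i)
      else if c == b then clip k (X c om ord0 j) else 1)) =
      (fun om => clip m (xa om) * clip k (xb om)).
    apply/funext => om; rewrite -(prod_two _ _ ab); apply: eq_bigr => c _.
    by have [->//|_] := eqVneq c a; have [->//|_] := eqVneq c b.
  have -> : (fun om => \prod_(c < n) (if c == a then Y
      else if c == b then Z else fun=> 1) om) = (fun om => Y om * Z om).
    apply/funext => om; rewrite -(prod_two _ _ ab); apply: eq_bigr => c _.
    by case: (c == a); case: (c == b).
  move=> E1; have cb2 := c2 k _ mxb; have ca2 := c2 m _ mxa.
  have := cond_exp_orthogonal sG eZ GY (Lfun2M (Lfun2B cb2 Z2) Y2).
  under eq_Rintegral do rewrite mulrBl.
  rewrite RintegralB1 ?Lfun2M// => E2.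
  under eq_Rintegral do rewrite mulrBl.
  have EZ : \int[P]_om (Y om * Z om) = \int[P]_om (Z om * Y om).
    by apply: eq_Rintegral => om _; rewrite mulrC.
  have Ec : \int[P]_om (Y om * clip k (xb om)) = \int[P]_om (clip k (xb om) * Y om).
    by apply: eq_Rintegral => om _; rewrite mulrC.
  by rewrite RintegralB1 ?Lfun2M// E1 EZ Ec -opprB E2 oppr0.
have clip_noise m :
    \int[P]_om ((xb om - Hb om) * clip m (xa om)) = 0.
  have [Y eY] := ce m xa mxa.
  have ca2 := c2 m _ mxa.
  have Y2 := cond_exp_Lfun2 sG eY ca2; have [_ _ GY _] := eY.
  have cY2 := Lfun2B ca2 Y2; have n2 := Lfun2B xb2 hb2.
  have H1 := Rintegral_clip_limit (Lfun_measurable cY2) mxb (Lfun2M cY2 xb2)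
    (fun k => clip_clip m k Y eY).
  have H2 := cond_exp_orthogonal sG eY GHb (Lfun2M cY2 hb2).
  have H3 := cond_exp_orthogonal sG eB GY (Lfun2M n2 Y2).
  (* All three terms have mean zero: the first is the limit of [clip_clip] as the truncation of [xb]
     disappears, the other two pair a centred variable with a [G]-measurable one. *)
  have E : forall om, (xb om - Hb om) * clip m (xa om) =
     (clip m (xa om) - Y om) * xb om - (clip m (xa om) - Y om) * Hb om
     + (xb om - Hb om) * Y om by move=> om; ring.
  under eq_Rintegral do rewrite E.
  rewrite RintegralD1 ?RintegralB1 ?Lfun1B ?Lfun2M// H1 H2 H3; ring.
have n2 := Lfun2B xb2 hb2.
(* The truncation of [xa] is removed here; the remaining term in [Ha] vanishes by orthogonality. *)
have H1 := Rintegral_clip_limit (Lfun_measurable n2) mxa (Lfun2M n2 xa2) clip_noise.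
have H2 := cond_exp_orthogonal sG eB GHa (Lfun2M n2 ha2).
have E om : (X a om ord0 i - Ha om) * (X b om ord0 j - Hb om) =
    (xb om - Hb om) * xa om - (xb om - Hb om) * Ha om by rewrite /xa /xb; ring.
under eq_Rintegral do rewrite E.
by rewrite RintegralB1 ?Lfun2M// H1 H2 subrr.
Qed.

End conditional_independence.

(** * Random vectors *)

Section random_vectors.
Context (R : realType) (d : measure_display) (Omega : measurableType d)
  (P : probability Omega R) (D : nat).
Implicit Types (X Y V : Omega -> 'rV[R]_D) (G : set (set Omega)).

Definition vec_measurable G X :=
  forall j, sub_measurable G (fun om => X om ord0 j).

Definition vec_Lfun2 X := forall j, (fun om => X om ord0 j) \in Lfun P 2%:E%E.

Lemma vec_measurable_subset G G' X : G `<=` G' ->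
  vec_measurable G X -> vec_measurable G' X.
Proof. by move=> GG mX j; exact: sub_measurable_subset (mX j). Qed.

Lemma vec_measurable_cst G (a : 'rV[R]_D) : sub_sigma G ->
  vec_measurable G (fun=> a).
Proof. by move=> sG j; apply/sub_measurableP => //; exact: measurable_cst. Qed.

Lemma vec_measurableD G X Y : sub_sigma G -> vec_measurable G X ->
  vec_measurable G Y -> vec_measurable G (fun om => X om + Y om).
Proof.
move=> sG mX mY j; apply/sub_measurableP => //; under eq_fun do rewrite mxE.
by apply: measurable_funD; apply/sub_measurableP.
Qed.

Lemma vec_measurableZ G (a : R) X : sub_sigma G -> vec_measurable G X ->
  vec_measurable G (fun om => a *: X om).
Proof.
move=> sG mX j; apply/sub_measurableP => //; under eq_fun do rewrite mxE.
by apply: measurable_funM; [exact: measurable_cst|apply/sub_measurableP].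
Qed.

Lemma vec_measurable_sum G (n : nat) (X : 'I_n -> Omega -> 'rV[R]_D) :
  sub_sigma G -> (forall i, vec_measurable G (X i)) ->
  vec_measurable G (fun om => \sum_i X i om).
Proof.
move=> sG mX j; apply/sub_measurableP => //; under eq_fun do rewrite summxE.
by apply: measurable_sum => i; apply/sub_measurableP => //; exact: mX.
Qed.

Lemma vec_Lfun2_cst (a : 'rV[R]_D) : vec_Lfun2 (fun=> a).
Proof. by move=> j; exact: (Lfun_cst P (a ord0 j) 2). Qed.

Lemma vec_Lfun2D X Y : vec_Lfun2 X -> vec_Lfun2 Y ->
  vec_Lfun2 (fun om => X om + Y om).
Proof. by move=> X2 Y2 j; under eq_fun do rewrite mxE; exact: Lfun2D. Qed.

Lemma vec_Lfun2Z (a : R) X : vec_Lfun2 X -> vec_Lfun2 (fun om => a *: X om).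
Proof. by move=> X2 j; under eq_fun do rewrite mxE; exact: Lfun2Z. Qed.

Lemma vec_Lfun2B X Y : vec_Lfun2 X -> vec_Lfun2 Y ->
  vec_Lfun2 (fun om => X om - Y om).
Proof. by move=> X2 Y2 j; under eq_fun do rewrite !mxE; exact: Lfun2B. Qed.

Lemma vec_Lfun2_sum (n : nat) (X : 'I_n -> Omega -> 'rV[R]_D) :
  (forall i, vec_Lfun2 (X i)) -> vec_Lfun2 (fun om => \sum_i X i om).
Proof.
by move=> X2 j; under eq_fun do rewrite summxE; apply: Lfun2_sum => i; exact: X2.
Qed.

Lemma dotv_Lfun1 X Y : vec_Lfun2 X -> vec_Lfun2 Y ->
  (fun om => dotv (X om) (Y om)) \in Lfun P 1%E.
Proof. by move=> X2 Y2; apply: Lfun1_sum => j; exact: Lfun2M. Qed.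

Lemma sqnorm_Lfun1 X : vec_Lfun2 X -> (fun om => sqnorm (X om)) \in Lfun P 1%E.
Proof. by move=> X2; exact: dotv_Lfun1. Qed.

Lemma lipschitz_coord (phi : 'rV[R]_D -> 'rV[R]_D) (K : R) j x y :
  lipschitz_sq phi K ->
  (phi x ord0 j - phi y ord0 j) ^+ 2 <= K ^+ 2 * sqnorm (x - y).
Proof.
move=> phiK; apply: le_trans (phiK x y); apply: le_trans (sqr_coord_le _ j).
by rewrite !mxE.
Qed.

Lemma vec_measurable_lipschitz G (phi : 'rV[R]_D -> 'rV[R]_D) (K : R) X :
  sub_sigma G -> lipschitz_sq phi K -> vec_measurable G X ->
  vec_measurable G (fun om => phi (X om)).
Proof.
move=> sG phiK mX j; apply/sub_measurableP => //.
apply: (@measurable_lipschitz_comp _ (g_sigma_algebraType G) _ _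
  (fun x => phi x ord0 j) K X).
  by move=> x y; exact: lipschitz_coord.
by move=> i; apply/sub_measurableP.
Qed.

(** Once the constant [phi 0] is subtracted, each coordinate is bounded by [K |X|]; constants are
    square-integrable under a probability. *)
Lemma vec_Lfun2_lipschitz (phi : 'rV[R]_D -> 'rV[R]_D) (K : R) X :
  lipschitz_sq phi K -> vec_Lfun2 X -> vec_Lfun2 (fun om => phi (X om)).
Proof.
move=> phiK X2 j.
have mX i : measurable_fun setT (fun om => X om ord0 i) := Lfun_measurable (X2 i).
have mphi : measurable_fun setT (fun om => phi (X om) ord0 j).
  apply: (@measurable_lipschitz_comp _ _ _ _ (fun x => phi x ord0 j) K X) => //.
  by move=> x y; exact: lipschitz_coord.
have -> : (fun om => phi (X om) ord0 j) =
    (fun om => (phi (X om) ord0 j - phi 0 ord0 j) + phi 0 ord0 j).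
  by apply/funext => om; rewrite subrK.
apply: Lfun2D; last exact: (Lfun_cst P (phi 0 ord0 j) 2).
have mB : measurable_fun setT (fun om => phi (X om) ord0 j - phi 0 ord0 j).
  by apply: measurable_funB => //; exact: measurable_cst.
apply: sqr_integrable_Lfun2 => //; apply/Lfun1_integrable.
apply: (Lfun1_le _ (Lfun1Z (K ^+ 2) (sqnorm_Lfun1 X2))) => [|om].
  exact: measurable_funX.
rewrite ger0_norm ?sqr_ge0// (le_trans _ (ler_norm _))//.
by rewrite -{2}[X om]subr0; exact: lipschitz_coord.
Qed.


(** Turns a second-moment bound on an extended-real integral into square integrability, since each
    squared coordinate is below the squared norm. *)
Lemma integral_sqnorm_Lfun2 X (M : R) :
  (forall j, measurable_fun setT (fun om => X om ord0 j)) ->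
  (\int[P]_om (sqnorm (X om))%:E <= M%:E)%E -> vec_Lfun2 X.
Proof.
move=> mX XM j; apply: sqr_integrable_Lfun2 => //; apply/integrableP; split.
  by apply/measurable_EFinP; exact: measurable_funX.
apply: (@le_lt_trans _ _ M%:E); last exact: ltry.
apply: le_trans XM; apply: ge0_le_integral => //.
- by apply/measurable_EFinP; apply: measurableT_comp => //; exact: measurable_funX.
- by apply/measurable_EFinP; apply: measurable_sum => i; exact: measurable_funM.
- by move=> om _ /=; rewrite lee_fin ger0_norm ?sqr_ge0// sqr_coord_le.
Qed.

Lemma sqnorm_EFin_Rintegral X : vec_Lfun2 X ->
  (\int[P]_om (sqnorm (X om))%:E = (\int[P]_om sqnorm (X om))%:E)%E.
Proof.
move=> X2; rewrite /Rintegral fineK// integrable_fin_num//.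
exact/Lfun1_integrable/sqnorm_Lfun1.
Qed.

(** * Noise averaged over the clients *)

Section noise.
Context (G : set (set Omega)) (n : nat) (p : 'I_n -> R)
  (X H : 'I_n -> Omega -> 'rV[R]_D).
Hypothesis sG : sub_sigma G.
Hypothesis X2 : forall i, vec_Lfun2 (X i).
Hypothesis XH : forall i j,
  is_cond_exp P G (fun om => X i om ord0 j) (fun om => H i om ord0 j).

Let N i om := X i om - H i om.

Lemma noise_Lfun2 i : vec_Lfun2 (N i).
Proof.
by apply: vec_Lfun2B => // j; apply: cond_exp_Lfun2 (XH i j) (X2 i j).
Qed.

Lemma noise_orthogonal V : vec_measurable G V -> vec_Lfun2 V ->
  \int[P]_om dotv (V om) (\sum_i p i *: N i om) = 0.
Proof.
move=> mV V2.
have E om : dotv (V om) (\sum_i p i *: N i om) =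
    \sum_i p i * dotv (V om) (N i om).
  by rewrite dotv_sumr; apply: eq_bigr => i _; rewrite dotvZr.
under eq_Rintegral do rewrite E.
have VN i : (fun om => dotv (V om) (N i om)) \in Lfun P 1%E.
  by apply: dotv_Lfun1 => //; exact: noise_Lfun2.
rewrite Rintegral_sum1 => [|i]; last exact: Lfun1Z.
rewrite big1// => i _; rewrite RintegralZ1// Rintegral_sum1 => [|j]; last first.
  by apply: Lfun2M => //; exact: noise_Lfun2.
rewrite big1 ?mulr0// => j _.
have := cond_exp_orthogonal sG (XH i j) (mV j).
have NV : (fun om => N i om ord0 j * V om ord0 j) \in Lfun P 1%E.
  by apply: Lfun2M => //; exact: noise_Lfun2.
have NE : (fun om => (X i om ord0 j - H i om ord0 j) * V om ord0 j) =
    (fun om => N i om ord0 j * V om ord0 j) by apply/funext => om; rewrite !mxE.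
rewrite NE => /(_ NV) NV0; rewrite -[RHS]NV0.
by apply: eq_Rintegral => om _; rewrite mulrC.
Qed.

(* The cross terms vanish by conditional independence. *)
Lemma noise_variance (s2 : R) : cond_indep P G X ->
  (forall i, \int[P]_om sqnorm (N i om) <= s2) ->
  \int[P]_om sqnorm (\sum_i p i *: N i om) <= \sum_i p i ^+ 2 * s2.
Proof.
move=> ind Ns.
have NN i l : (fun om => dotv (N i om) (N l om)) \in Lfun P 1%E.
  by apply: dotv_Lfun1; exact: noise_Lfun2.
have E om : sqnorm (\sum_i p i *: N i om) =
    \sum_i \sum_l (p i * p l) * dotv (N i om) (N l om).
  rewrite /sqnorm dotv_suml; apply: eq_bigr => i _.
  by rewrite dotv_sumr; apply: eq_bigr => l _; rewrite dotvZl dotvZr mulrA.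
under eq_Rintegral do rewrite E.
rewrite Rintegral_sum1 => [|i]; last by apply: Lfun1_sum => l; exact: Lfun1Z.
apply: ler_sum => i _.
rewrite Rintegral_sum1 => [|l]; last exact: Lfun1Z.
(* The diagonal term is the variance of client [i]; every other term pairs two distinct clients. *)
rewrite (bigD1 i)//= RintegralZ1// big1 ?addr0 => [|l li].
  by rewrite -expr2 ler_wpM2l ?sqr_ge0//; exact: Ns.
rewrite RintegralZ1// Rintegral_sum1 => [|j]; last first.
  by apply: Lfun2M; exact: noise_Lfun2.
rewrite big1 ?mulr0// => j _.
rewrite eq_sym in li.
rewrite -[RHS](cond_indep_uncorrelated sG ind li (XH i j) (XH l j) (X2 i j) (X2 l j)).
by apply: eq_Rintegral => om _; rewrite !mxE.
Qed.

End noise.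
End random_vectors.

(** * FedProx *)

Section fedprox.
Context (R : realType) (d : measure_display) (Omega : measurableType d)
  (P : probability Omega R) (C D E T : nat) (p : 'I_C -> R)
  (F : 'I_C -> 'rV[R]_D -> R) (gradF : 'I_C -> 'rV[R]_D -> 'rV[R]_D)
  (alpha L sigma Gb gamma : R) (w0 : 'rV[R]_D)
  (g : 'I_C -> nat -> nat -> Omega -> 'rV[R]_D)
  (Fil : nat -> set (set Omega)).
Hypothesis Hp0 : forall i, 0 <= p i.
Hypothesis Hp1 : \sum_(i < C) p i = 1.
Hypothesis HL : 0 <= L.
Hypothesis Halpha : 0 <= alpha.
Hypothesis gamma0 : 0 <= gamma.
Hypothesis alphagamma : alpha * gamma <= 1.
Hypothesis Lgamma : L * gamma <= 1.
Hypothesis HgradF : forall i, is_gradient (F i) (gradF i).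
Hypothesis Hsmooth : forall i, lipschitz_sq (gradF i) L.
Hypothesis HFil : forall s, sub_sigma (Fil s).
Hypothesis HFilmono : forall s, Fil s `<=` Fil s.+1.
Hypothesis Hadapt : forall i t k (j : 'I_D), (t < T)%N -> (k < E)%N ->
  sub_measurable (Fil (t * E + k)%N.+1) (fun om => g i t k om ord0 j).

Local Notation start t om := (round_start E p alpha gamma w0 g t om).
Local Notation wl i t k om := (wloc E p alpha gamma w0 g i t k om).
Local Notation w t k om := (wavg E p alpha gamma w0 g t k om).

Hypothesis Hunbiased : forall i t k (j : 'I_D), (t < T)%N -> (k < E)%N ->
  is_cond_exp P (Fil (t * E + k)%N) (fun om => g i t k om ord0 j)
    (fun om => gradF i (wl i t k om) ord0 j).
Hypothesis Hindep : forall t k, (t < T)%N -> (k < E)%N ->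
  cond_indep P (Fil (t * E + k)%N) (fun i => g i t k).
Hypothesis Hvar : forall i t k, (t < T)%N -> (k < E)%N ->
  (\int[P]_om (sqnorm (g i t k om - gradF i (wl i t k om)))%:E
    <= (sigma ^+ 2)%:E)%E.
Hypothesis Hbound : forall i t k, (t < T)%N -> (k < E)%N ->
  (\int[P]_om (sqnorm (g i t k om))%:E <= (Gb ^+ 2)%:E)%E.

Let Fg x := \sum_(i < C) p i * F i x.
Let gradFg x := \sum_(i < C) p i *: gradF i x.
Let meangrad t k om := \sum_(i < C) p i *: gradF i (wl i t k om).
Let noise t k om := \sum_(i < C) p i *: (g i t k om - gradF i (wl i t k om)).
Let drift t k om := meangrad t k om + alpha *: (w t k om - start t om).

(** * The averaged recursion, measurability and square integrability of the iterates *)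

Lemma wavg0 t om : w t 0 om = start t om.
Proof. by rewrite /wavg /wloc /= -scaler_suml Hp1 scale1r. Qed.

Lemma wavgE t om : w t E om = w t.+1 0 om.
Proof. by rewrite wavg0. Qed.

(** Since the weights sum to 1, the proximal parts average to [w - alpha gamma (w - start)]; this
    pull is absorbed in the drift. *)
Lemma wavgS t k om :
  w t k.+1 om = w t k om + - gamma *: (drift t k om + noise t k om).
Proof.
have -> : drift t k om + noise t k om =
    \sum_(i < C) p i *: g i t k om + alpha *: (w t k om - start t om).
  rewrite /noise (eq_bigr (fun i => p i *: g i t k om
    - p i *: gradF i (wl i t k om))) => [|i _]; last by rewrite scalerBr.
  by rewrite sumrB /drift -/(meangrad t k om) addrC addrA subrK.
rewrite [LHS]/wavg /wloc /=.
rewrite (eq_bigr (fun i => (1 - alpha * gamma) *: (p i *: wl i t k om)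
    + p i *: ((alpha * gamma) *: start t om) + - gamma *: (p i *: g i t k om))).
  rewrite !big_split /= -!scaler_sumr -scaler_suml Hp1 scale1r -/(wavg _ _ _ _ _ _ _ _ _).
  by apply/rowP => j; rewrite !mxE; ring.
move=> i _; apply/rowP => j; rewrite !mxE; ring.
Qed.

Lemma Fil_le s s' : (s <= s')%N -> Fil s `<=` Fil s'.
Proof.
by move=> /subnK <-; elim: (s' - s)%N => // n IH A /IH; exact: HFilmono.
Qed.

Lemma g_Lfun2 i t k : (t < T)%N -> (k < E)%N -> vec_Lfun2 P (g i t k).
Proof.
move=> tT kE; apply: integral_sqnorm_Lfun2 (Hbound i tT kE) => j.
exact: sub_measurable_measurable (HFil _) (Hadapt i j tT kE).
Qed.

(** The iterate after [k] local steps involves only gradients of steps [j < k], known from index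
    [t * E + j + 1] on. *)
Lemma local_iter_measurable i t k : (t < T)%N -> (k <= E)%N ->
  vec_measurable (Fil (t * E)) (fun om => start t om) ->
  vec_measurable (Fil (t * E + k)) (fun om => wl i t k om).
Proof.
move=> tT kE ms; rewrite /wloc; elim: k kE => [|k IH] kE /=; first by rewrite addn0.
have le1 : (t * E + k <= t * E + k.+1)%N by rewrite leq_add2l.
have sG := HFil (t * E + k.+1).
apply: vec_measurableD => //.
  apply: vec_measurableD => //; apply: vec_measurableZ => //.
    by apply: vec_measurable_subset (Fil_le le1) (IH (ltnW kE)).
  by apply: vec_measurable_subset (Fil_le _) ms; rewrite leq_addr.
under eq_fun do rewrite -scaleNr.
by apply: vec_measurableZ => // j; rewrite addnS; exact: Hadapt.
Qed.

Lemma start_measurable t : (t <= T)%N ->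
  vec_measurable (Fil (t * E)) (fun om => start t om).
Proof.
elim: t => [|t IH] tT /=; first exact: vec_measurable_cst.
apply: vec_measurable_sum => // i; apply: vec_measurableZ => //.
(* The next round starts at index [t * E + E], where all [E] local steps of round [t] are known. *)
by rewrite mulSn addnC; apply: local_iter_measurable => //; exact: IH (ltnW tT).
Qed.

Lemma wloc_measurable i t k : (t < T)%N -> (k < E)%N ->
  vec_measurable (Fil (t * E + k)) (fun om => wl i t k om).
Proof.
move=> tT kE; apply: local_iter_measurable (ltnW kE) _ => //.
exact: start_measurable (ltnW tT).
Qed.

Lemma local_iter_Lfun2 i t k : (t < T)%N -> (k <= E)%N ->
  vec_Lfun2 P (fun om => start t om) -> vec_Lfun2 P (fun om => wl i t k om).
Proof.
move=> tT kE s2; rewrite /wloc; elim: k kE => [|k IH] kE //=.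
apply: vec_Lfun2B; last by apply: vec_Lfun2Z; exact: g_Lfun2.
apply: vec_Lfun2D; last exact: vec_Lfun2Z.
by apply: vec_Lfun2Z; exact: IH (ltnW kE).
Qed.

Lemma start_Lfun2 t : (t <= T)%N -> vec_Lfun2 P (fun om => start t om).
Proof.
elim: t => [|t IH] tT /=; first exact: vec_Lfun2_cst.
apply: vec_Lfun2_sum => // i; apply: vec_Lfun2Z => //.
by apply: local_iter_Lfun2 => //; exact: IH (ltnW tT).
Qed.

Lemma wloc_Lfun2 i t k : (t < T)%N -> (k < E)%N ->
  vec_Lfun2 P (fun om => wl i t k om).
Proof.
move=> tT kE; apply: local_iter_Lfun2 (ltnW kE) _ => //.
exact: start_Lfun2 (ltnW tT).
Qed.

Lemma gradFg_lipschitz : lipschitz_sq gradFg L.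
Proof.
move=> x y; rewrite /gradFg -sumrB; under eq_bigr do rewrite -scalerBr.
apply: (le_trans (sqnorm_convex _ Hp0 Hp1)).
rewrite -[leRHS]mul1r -[X in _ <= X * _]Hp1 mulr_suml; apply: ler_sum => i _.
by rewrite ler_wpM2l//; exact: Hsmooth.
Qed.

(** * Analysis of one averaged step *)

Section step.
Variables (t k : nat).
Hypotheses (tT : (t < T)%N) (kE : (k < E)%N).
Let G := Fil (t * E + k).
Let sG : sub_sigma G := HFil _.

Lemma wavg_measurable : vec_measurable G (fun om => w t k om).
Proof.
apply: vec_measurable_sum => // i; apply: vec_measurableZ => //.
exact: wloc_measurable.
Qed.

Lemma wavg_Lfun2 : vec_Lfun2 P (fun om => w t k om).
Proof.
by apply: vec_Lfun2_sum => i; apply: vec_Lfun2Z; exact: wloc_Lfun2.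
Qed.

Lemma gradFg_measurable : vec_measurable G (fun om => gradFg (w t k om)).
Proof. exact: vec_measurable_lipschitz gradFg_lipschitz wavg_measurable. Qed.

Lemma gradFg_Lfun2 : vec_Lfun2 P (fun om => gradFg (w t k om)).
Proof. exact: vec_Lfun2_lipschitz gradFg_lipschitz wavg_Lfun2. Qed.

Lemma drift_measurable : vec_measurable G (drift t k).
Proof.
apply: vec_measurableD => //.
  apply: vec_measurable_sum => // i; apply: vec_measurableZ => //.
  by apply: vec_measurable_lipschitz (Hsmooth i) _ => //; exact: wloc_measurable.
apply: vec_measurableZ => //; under eq_fun do rewrite -scaleN1r.
apply: vec_measurableD => //; first exact: wavg_measurable.
apply: vec_measurableZ => //.
by apply: vec_measurable_subset (Fil_le _) (start_measurable (ltnW tT)); rewrite leq_addr.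
Qed.

Lemma drift_Lfun2 : vec_Lfun2 P (drift t k).
Proof.
apply: vec_Lfun2D.
  apply: vec_Lfun2_sum => i; apply: vec_Lfun2Z.
  by apply: vec_Lfun2_lipschitz (Hsmooth i) _; exact: wloc_Lfun2.
apply: vec_Lfun2Z; apply: vec_Lfun2B; first exact: wavg_Lfun2.
exact: start_Lfun2 (ltnW tT).
Qed.

Lemma noise_step_Lfun2 : vec_Lfun2 P (noise t k).
Proof.
apply: vec_Lfun2_sum => i; apply: vec_Lfun2Z.
apply: (noise_Lfun2 sG (X := fun i => g i t k)
  (H := fun i om => gradF i (wl i t k om))) => [c|c j]; first exact: g_Lfun2.
exact: Hunbiased.
Qed.

Lemma noise_step_orthogonal V : vec_measurable G V -> vec_Lfun2 P V ->
  \int[P]_om dotv (V om) (noise t k om) = 0.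
Proof.
apply: (noise_orthogonal p sG (X := fun i => g i t k)
  (H := fun i om => gradF i (wl i t k om))) => [c|c j]; first exact: g_Lfun2.
exact: Hunbiased.
Qed.

Lemma noise_step_variance :
  \int[P]_om sqnorm (noise t k om) <= (\sum_(i < C) p i ^+ 2) * sigma ^+ 2.
Proof.
rewrite mulr_suml.
apply: (noise_variance p sG (X := fun i => g i t k)
  (H := fun i om => gradF i (wl i t k om))) => [c|c j||c].
- exact: g_Lfun2.
- exact: Hunbiased.
- exact: Hindep.
rewrite -lee_fin -sqnorm_EFin_Rintegral; first exact: Hvar.
apply: vec_Lfun2B; first exact: g_Lfun2.
by apply: vec_Lfun2_lipschitz (Hsmooth c) _; exact: wloc_Lfun2.
Qed.

(* The error is [(gradFg w - meangrad) - alpha (w - start)]; the weighted sum of the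
   local deviations [|w^i - start|^2] controls both terms. *)
Lemma drift_error om :
  sqnorm (gradFg (w t k om) - drift t k om) <=
  2 * (L ^+ 2 + alpha ^+ 2) *
    \sum_(i < C) p i * (gamma ^+ 2 * (k%:R * \sum_(j < k) sqnorm (g i t j om))).
Proof.
set Q := \sum_(i < C) _.
have dev i : sqnorm (wl i t k om - start t om) <=
    gamma ^+ 2 * (k%:R * \sum_(j < k) sqnorm (g i t j om)).
  apply: (local_iter_dev (start t om) (fun k => g i t k om) k).
  by rewrite mulr_ge0.
have devQ : \sum_(i < C) p i * sqnorm (wl i t k om - start t om) <= Q.
  by apply: ler_sum => i _; rewrite ler_wpM2l.
(* Jensen over the clients, then smoothness of each, then the fact that the weighted mean is the
   best centre, which lets [start] replace [w]. *)
have H1 : sqnorm (gradFg (w t k om) - meangrad t k om) <= L ^+ 2 * Q.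
  rewrite /gradFg /meangrad -sumrB; under eq_bigr do rewrite -scalerBr.
  apply: (le_trans (sqnorm_convex _ Hp0 Hp1)).
  apply: (@le_trans _ _ (L ^+ 2 * \sum_(i < C) p i * sqnorm (wl i t k om - w t k om))).
    rewrite mulr_sumr; apply: ler_sum => i _; rewrite mulrCA ler_wpM2l//.
    apply: (le_trans (Hsmooth i _ _)).
    by rewrite ler_wpM2l ?sqr_ge0// -[w t k om - _]opprB -scaleN1r sqnormZ sqrrN expr1n mul1r.
  rewrite ler_wpM2l ?sqr_ge0//; apply: le_trans devQ.
  exact: sum_sqnorm_mean_le.
have H2 : sqnorm (w t k om - start t om) <= Q.
  apply: le_trans devQ.
  have -> : w t k om - start t om = \sum_(i < C) p i *: (wl i t k om - start t om).
    by under eq_bigr do rewrite scalerBr; rewrite sumrB -scaler_suml Hp1 scale1r.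
  exact: sqnorm_convex.
rewrite /drift opprD addrA -scaleNr.
apply: (le_trans (sqnormD_le _ _)); rewrite sqnormZ sqrrN.
have := ler_wpM2l (sqr_ge0 alpha) H2; lra.
Qed.

(** Each of the [k] earlier squared gradients of the round has mean at most [Gb^2]; with the factor
    [k] this is [k^2 Gb^2], and [k < E]. *)
Lemma drift_error_mean :
  \int[P]_om sqnorm (gradFg (w t k om) - drift t k om) <=
  2 * (L ^+ 2 + alpha ^+ 2) * (gamma ^+ 2 * (E%:R ^+ 2 * Gb ^+ 2)).
Proof.
have g1 i (j : 'I_k) : (fun om => sqnorm (g i t j om)) \in Lfun P 1%E.
  by apply: sqnorm_Lfun1; apply: g_Lfun2 => //; exact: ltn_trans (ltn_ord j) kE.
have gs1 i : (fun om => k%:R * \sum_(j < k) sqnorm (g i t j om)) \in Lfun P 1%E.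
  by apply: Lfun1Z; exact: Lfun1_sum.
have gg1 i : (fun om => gamma ^+ 2 * (k%:R * \sum_(j < k) sqnorm (g i t j om)))
   \in Lfun P 1%E by exact: Lfun1Z.
have pg1 i : (fun om => p i * (gamma ^+ 2 * (k%:R * \sum_(j < k) sqnorm (g i t j om))))
   \in Lfun P 1%E by exact: Lfun1Z.
have gs i : \int[P]_om (\sum_(j < k) sqnorm (g i t j om)) <= k%:R * Gb ^+ 2.
  rewrite Rintegral_sum1// -[k in k%:R]card_ord -sum1_card natr_sum mulr_suml.
  apply: ler_sum => j _; rewrite mul1r.
  have jE := ltn_trans (ltn_ord j) kE.
  rewrite -lee_fin -sqnorm_EFin_Rintegral; last exact: g_Lfun2.
  exact: Hbound.
have c0 : 0 <= 2 * (L ^+ 2 + alpha ^+ 2).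
  by rewrite mulr_ge0// addr_ge0// sqr_ge0.
apply: (@le_trans _ _ (\int[P]_om (2 * (L ^+ 2 + alpha ^+ 2) *
    \sum_(i < C) p i * (gamma ^+ 2 * (k%:R * \sum_(j < k) sqnorm (g i t j om)))))).
  apply: le_Rintegral1 => [||om]; last exact: drift_error.
    by apply: sqnorm_Lfun1; apply: vec_Lfun2B; [exact: gradFg_Lfun2|exact: drift_Lfun2].
  by apply: Lfun1Z; exact: Lfun1_sum.
rewrite RintegralZ1; last exact: Lfun1_sum.
rewrite ler_wpM2l// Rintegral_sum1//.
rewrite -[leRHS]mul1r -[X in _ <= X * _]Hp1 mulr_suml; apply: ler_sum => i _.
rewrite RintegralZ1// ler_wpM2l// RintegralZ1// ler_wpM2l ?sqr_ge0//.
rewrite RintegralZ1; last exact: Lfun1_sum.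
have kER : (k%:R : R) <= E%:R by rewrite ler_nat ltnW.
apply: (@le_trans _ _ (k%:R * (k%:R * Gb ^+ 2))); first by rewrite ler_wpM2l.
by rewrite mulrA -expr2 ler_wpM2r ?sqr_ge0// lerXn2r ?nnegrE.
Qed.

(** The right-hand side of [step_bound] for this step: an integrable pointwise majorant of the
    change of the objective. *)
Definition step_gap om : R :=
  - (gamma / 2) * sqnorm (gradFg (w t k om))
  + gamma / 2 * sqnorm (gradFg (w t k om) - drift t k om)
  - gamma * dotv (gradFg (w t k om)) (noise t k om)
  + L * gamma ^+ 2 * dotv (drift t k om) (noise t k om)
  + L * gamma ^+ 2 / 2 * sqnorm (noise t k om).

Lemma step_descent om : Fg (w t k.+1 om) - Fg (w t k om) <= step_gap om.
Proof.
rewrite lerBlDl; apply: le_trans (lerD (lexx _) (step_bound _ _ _ gamma0 Lgamma)).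
rewrite addrA wavgS.
exact: descent HL (gradient_sum p HgradF) gradFg_lipschitz.
Qed.

Lemma step_gap_Lfun1 : step_gap \in Lfun P 1%E.
Proof.
have v2 := gradFg_Lfun2; have u2 := drift_Lfun2; have n2 := noise_step_Lfun2.
apply: Lfun1D; last by apply: Lfun1Z; exact: sqnorm_Lfun1.
apply: Lfun1D; last by apply: Lfun1Z; exact: dotv_Lfun1.
apply: Lfun1B; last by apply: Lfun1Z; exact: dotv_Lfun1.
apply: Lfun1D; apply: Lfun1Z; first exact: sqnorm_Lfun1.
by apply: sqnorm_Lfun1; exact: vec_Lfun2B.
Qed.

(** Both inner products with the noise have mean zero; the drift error contributes [gamma / 2] times
    its bound, which is the term in [gamma^3]. *)
Lemma step_gap_mean : \int[P]_om step_gap om <=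
  - (gamma / 2) * \int[P]_om sqnorm (gradFg (w t k om))
  + gamma ^+ 3 * (L ^+ 2 + alpha ^+ 2) * (E%:R ^+ 2 * Gb ^+ 2)
  + L * gamma ^+ 2 / 2 * ((\sum_(i < C) p i ^+ 2) * sigma ^+ 2).
Proof.
have v2 := gradFg_Lfun2; have u2 := drift_Lfun2; have n2 := noise_step_Lfun2.
have vu := sqnorm_Lfun1 (vec_Lfun2B v2 u2).
have vv := sqnorm_Lfun1 v2; have nn := sqnorm_Lfun1 n2.
have vn := dotv_Lfun1 v2 n2; have un := dotv_Lfun1 u2 n2.
have Vn := noise_step_orthogonal gradFg_measurable v2.
have Un := noise_step_orthogonal drift_measurable u2.
have S12 := Lfun1D (Lfun1Z (- (gamma / 2)) vv) (Lfun1Z (gamma / 2) vu).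
have S3 := Lfun1B S12 (Lfun1Z gamma vn).
have S4 := Lfun1D S3 (Lfun1Z (L * gamma ^+ 2) un).
rewrite /step_gap 2?RintegralD1 ?RintegralB1 ?RintegralD1 ?RintegralZ1 ?Lfun1Z//.
rewrite Vn Un !mulr0 subr0 addr0.
have Lg : 0 <= L * gamma ^+ 2 / 2 by rewrite !mulr_ge0// ?sqr_ge0.
have g2 : 0 <= gamma / 2 by rewrite mulr_ge0.
have H1 := ler_wpM2l Lg noise_step_variance.
have H2 := ler_wpM2l g2 drift_error_mean.
lra.
Qed.

End step.

(** * Summation over all steps and the final rate *)

(** The objective telescopes inside each round, and rounds chain because the last local average is
    the next starting point. *)
Lemma step_gap_telescope om :
  Fg (w T 0 om) - Fg w0 <= \sum_(t < T) \sum_(k < E) step_gap t k om.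
Proof.
have -> : Fg (w T 0 om) - Fg w0 =
    \sum_(0 <= t < T) (Fg (w t.+1 0 om) - Fg (w t 0 om)).
  by rewrite (telescope_sumr (fun t => Fg (w t 0 om)))// (wavg0 0).
rewrite big_mkord; apply: ler_sum => t _; rewrite -wavgE.
rewrite -(telescope_sumr (fun k => Fg (w t k om)) (leq0n E)) big_mkord.
by apply: ler_sum => k _; exact: step_descent.
Qed.

Lemma sum_sqnorm_grad_le (finf : R) : (forall x, finf <= Fg x) ->
  gamma / 2 * \sum_(t < T) \sum_(k < E) \int[P]_om sqnorm (gradFg (w t k om)) <=
  Fg w0 - finf + (T * E)%:R *
    (gamma ^+ 3 * (L ^+ 2 + alpha ^+ 2) * (E%:R ^+ 2 * Gb ^+ 2)
     + L * gamma ^+ 2 / 2 * ((\sum_(i < C) p i ^+ 2) * sigma ^+ 2)).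
Proof.
move=> Finf; set B := _ + L * gamma ^+ 2 / 2 * _.
have s1 (t : 'I_T) : (fun om => \sum_(k < E) step_gap t k om) \in Lfun P 1%E.
  by apply: Lfun1_sum => k; exact: step_gap_Lfun1.
(* The final objective value is replaced by [finf] before integrating, so the left-hand side is a
   constant. *)
have H : finf - Fg w0 <= \int[P]_om \sum_(t < T) \sum_(k < E) step_gap t k om.
  have <- : \int[P]_x (finf - Fg w0) = finf - Fg w0.
    rewrite Rintegral_cst// -[RHS]mulr1; congr (_ * _).
    exact: (congr1 fine (probability_setT P)).
  apply: le_Rintegral1; [exact: (Lfun_cst P _ 1)|exact: Lfun1_sum|move=> om].
  by apply: le_trans (step_gap_telescope om); rewrite lerD2r.
rewrite Rintegral_sum1// in H.
suff H2 : \sum_(t < T) \int[P]_om (\sum_(k < E) step_gap t k om) <=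
    - (gamma / 2 * \sum_(t < T) \sum_(k < E) \int[P]_om sqnorm (gradFg (w t k om)))
    + (T * E)%:R * B by lra.
have -> : (T * E)%:R * B = \sum_(t < T) \sum_(k < E) B.
  by rewrite !sumr_const !card_ord -mulrnA mulnC mulr_natl.
rewrite mulr_sumr -sumrN -big_split; apply: ler_sum => t _ /=.
rewrite Rintegral_sum1 => [|k]; last exact: step_gap_Lfun1.
rewrite mulr_sumr -sumrN -big_split; apply: ler_sum => k _ /=.
by rewrite -mulNr /B addrA; exact: step_gap_mean.
Qed.

End fedprox.

(* [x] and [y] stand for [sqrt T] and [sqrt E]. *)
Lemma rate_bound (R : realType) (x y a alpha L Delta S2 G2 gamma V : R) :
  1 <= x -> 1 <= y -> 0 < alpha -> 0 <= L -> a = alpha + L -> 0 <= Delta ->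
  0 <= S2 -> 0 <= G2 -> gamma = (2 * a * (x * y))^-1 ->
  gamma / 2 * V <= Delta + x ^+ 2 * y ^+ 2 *
    (gamma ^+ 3 * (L ^+ 2 + alpha ^+ 2) * ((y ^+ 2) ^+ 2 * G2)
     + L * gamma ^+ 2 / 2 * S2) ->
  (x ^+ 2 * y ^+ 2)^-1 * V <=
  x^-1 * (8 * a * Delta / y + L * S2 / (a * y) + alpha * (y ^+ 2 * y) * G2 / a)
  + 2 * L ^+ 2 * y ^+ 2 * G2 / (a ^+ 2 * x ^+ 2)
  + alpha ^+ 2 * L * y * G2 / (16 * a ^+ 3 * (x ^+ 2 * x)).
Proof.
move=> x1 y1 alpha0 L0 aE D0 S0 G0 gE H.
have x0 : 0 < x by lra. have y0 : 0 < y by lra.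
have a0 : 0 < a by rewrite aE; lra.
have xn : x != 0 by rewrite gt_eqF. have yn : y != 0 by rewrite gt_eqF.
have an : a != 0 by rewrite gt_eqF.
have n0 : 0 < x ^+ 2 * y ^+ 2 by rewrite mulr_gt0 ?exprn_gt0.
rewrite mulrC ler_pdivrMr//.
have c0 : 0 < gamma / 2 by rewrite gE divr_gt0// invr_gt0 !mulr_gt0.
rewrite -(ler_pM2l c0); apply: (le_trans H).
rewrite -subr_ge0 gE.
(* The difference of the two sides is an explicit sum of terms that are nonnegative once
   [2 a x y >= alpha], which holds because [a >= alpha] and [x y >= 1]. *)
rewrite (_ : _ - _ = Delta + L * S2 / (8 * a ^+ 2)
  + 3 * L ^+ 2 * y ^+ 3 * G2 / (8 * a ^+ 3 * x)
  + alpha * y ^+ 3 * G2 / (8 * a ^+ 3 * x) * (2 * a * x * y - alpha)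
  + alpha ^+ 2 * L * y ^+ 2 * G2 / (64 * a ^+ 4 * x ^+ 2)); last first.
  by field; rewrite xn yn an.
have aalpha : 0 <= 2 * a * x * y - alpha.
  have : 1 * 1 <= x * y by apply: ler_pM.
  by rewrite aE; nra.
by repeat first [assumption | by apply: ltW | by rewrite ler0n
  | apply: divr_ge0 | apply: mulr_ge0 | apply: exprn_ge0 | apply: addr_ge0].
Qed.

(** The uniform draw of the output is written out as the average over the [T * E] pairs [(t, k)].
    The integrals on the left are extended-real, so their finiteness is part of the conclusion. *)
Theorem theorem2
  (R : realType) (d : measure_display) (Omega : measurableType d)
  (P : probability Omega R)
  (C D E T : nat) (p : 'I_C -> R)
  (F : 'I_C -> 'rV[R]_D -> R) (gradF : 'I_C -> 'rV[R]_D -> 'rV[R]_D)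
  (gradFglob : 'rV[R]_D -> 'rV[R]_D)
  (alpha L sigma Gb finf gamma : R) (w0 : 'rV[R]_D)
  (g : 'I_C -> nat -> nat -> Omega -> 'rV[R]_D)
  (Fil : nat -> set (set Omega))
  (* client weights *)
  (Hp0 : forall i, 0 <= p i) (Hp1 : \sum_(i < C) p i = 1)
  (* parameters *)
  (Halpha : 0 < alpha) (HL : 0 <= L) (HE : (1 <= E)%N) (HT : (1 <= T)%N)
  (Hgamma : gamma = (2 * (alpha + L) * Num.sqrt (T * E)%:R)^-1)
  (* gradients; L-smoothness *)
  (HgradF : forall i, is_gradient (F i) (gradF i))
  (Hsmooth : forall i, lipschitz_sq (gradF i) L)
  (Hglob : is_gradient (fun x => \sum_(i < C) p i * F i x) gradFglob)
  (* lower-bounded objective *)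
  (Hinf : forall x, finf <= \sum_(i < C) p i * F i x)
  (* "the past": a filtration, step (t,k) having index t*E+k *)
  (HFil : forall s, sub_sigma (Fil s))
  (HFilmono : forall s, Fil s `<=` Fil s.+1)
  (* the stochastic gradient of step (t,k) is known after that step *)
  (Hadapt : forall i t k (j : 'I_D), (t < T)%N -> (k < E)%N ->
     sub_measurable (Fil (t * E + k)%N.+1) (fun om => g i t k om ord0 j))
  (* unbiasedness given the past *)
  (Hunbiased : forall i t k (j : 'I_D), (t < T)%N -> (k < E)%N ->
     is_cond_exp P (Fil (t * E + k)%N) (fun om => g i t k om ord0 j)
       (fun om => gradF i (wloc E p alpha gamma w0 g i t k om) ord0 j))
  (* independence across clients given the past *)
  (Hindep : forall t k, (t < T)%N -> (k < E)%N ->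
     cond_indep P (Fil (t * E + k)%N) (fun i => g i t k))
  (* bounded variance *)
  (Hvar : forall i t k, (t < T)%N -> (k < E)%N ->
     (\int[P]_om (sqnorm (g i t k om - gradF i (wloc E p alpha gamma w0 g i t k om)))%:E
       <= (sigma ^+ 2)%:E)%E)
  (* bounded stochastic gradient norm *)
  (Hbound : forall i t k, (t < T)%N -> (k < E)%N ->
     (\int[P]_om (sqnorm (g i t k om))%:E <= (Gb ^+ 2)%:E)%E) :
  (((T * E)%:R^-1)%:E *
     \sum_(t < T) \sum_(k < E)
        \int[P]_om (sqnorm (gradFglob (wavg E p alpha gamma w0 g t k om)))%:E
   <=
   ((Num.sqrt T%:R)^-1 *
      (8 * (alpha + L) * (\sum_(i < C) p i * F i w0 - finf) / Num.sqrt E%:R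
       + L * (\sum_(i < C) p i ^+ 2) * sigma ^+ 2 / ((alpha + L) * Num.sqrt E%:R)
       + alpha * (E%:R * Num.sqrt E%:R) * Gb ^+ 2 / (alpha + L))
    + 2 * L ^+ 2 * E%:R * Gb ^+ 2 / ((alpha + L) ^+ 2 * T%:R)
    + alpha ^+ 2 * L * Num.sqrt E%:R * Gb ^+ 2
        / (16 * (alpha + L) ^+ 3 * (T%:R * Num.sqrt T%:R)))%:E)%E.
Proof.
set a := alpha + L in Hgamma *.
have gE : gradFglob =1 (fun x => \sum_(i < C) p i *: gradF i x).
  by apply: gradient_uniq Hglob _; exact: gradient_sum.
have T0 : (0 : R) <= T%:R by []. have E0 : (0 : R) <= E%:R by [].
pose x := Num.sqrt (T%:R : R); pose y := Num.sqrt (E%:R : R).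
have xE : x ^+ 2 = T%:R by rewrite sqr_sqrtr.
have yE : y ^+ 2 = E%:R by rewrite sqr_sqrtr.
have x1 : 1 <= x by rewrite -sqrtr1 ler_wsqrtr// ler1n.
have y1 : 1 <= y by rewrite -sqrtr1 ler_wsqrtr// ler1n.
have {}Hgamma : gamma = (2 * a * (x * y))^-1.
  by rewrite Hgamma natrM sqrtrM.
have a0 : 0 < a by rewrite ltr_wpDr.
have xy1 : 1 <= x * y by rewrite -[leLHS]mul1r ler_pM.
have c0 : 0 < 2 * a * (x * y) by rewrite !mulr_gt0// (lt_le_trans ltr01).
have gamma0 : 0 <= gamma by rewrite Hgamma invr_ge0 ltW.
(* The step size gives [a * gamma = 1 / (2 x y) <= 1 / 2]; this covers both [alpha] and [L]. *)
have step c : c <= a -> c * gamma <= 1.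
  by move=> ca; rewrite Hgamma ler_pdivrMr// mul1r; nra.
have alphag : alpha * gamma <= 1 by apply: step; rewrite lerDl.
have Lg : L * gamma <= 1 by apply: step; rewrite lerDr ltW.
have v2 (t : 'I_T) (k : 'I_E) :
    vec_Lfun2 P (fun om => gradFglob (wavg E p alpha gamma w0 g t k om)).
  under eq_fun do rewrite gE.
  by apply: gradFg_Lfun2; eauto.
(* Square integrability makes every integral finite, so the remaining inequality is between
   reals. *)
have -> : (\sum_(t < T) \sum_(k < E)
    \int[P]_om (sqnorm (gradFglob (wavg E p alpha gamma w0 g t k om)))%:E =
  (\sum_(t < T) \sum_(k < E)
    (\int[P]_om sqnorm (\sum_(i < C) p i *: gradF i (wavg E p alpha gamma w0 g t k om)))%R)%:E)%E.
  rewrite -sumEFin; apply: eq_bigr => t _; rewrite -sumEFin; apply: eq_bigr => k _.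
  rewrite sqnorm_EFin_Rintegral//; congr (_%:E).
  by apply: eq_Rintegral => om _; rewrite gE.
rewrite -EFinM lee_fin natrM -/x -/y -xE -yE -[L * _ * _]mulrA.
apply: (rate_bound (gamma := gamma)) => //.
- by rewrite subr_ge0.
- by rewrite mulr_ge0 ?sqr_ge0// sumr_ge0// => i _; rewrite sqr_ge0.
- exact: sqr_ge0.
have := @sum_sqnorm_grad_le R d Omega P C D E T p F gradF alpha L sigma Gb gamma w0 g Fil.
rewrite natrM -xE -yE; apply => //; exact: ltW.
Qed.
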